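(* Let $m,\nu,\kappa,\lambda,c,T>0$ and $y^0=(q^0,p^0,\theta^0)\in\mathbb R^2\times(0,\infty)$. With the incremental functional $G$ of the damped harmonic oscillator defined in the context, consider for a partition $0=t_0<t_1<\dots<t_N=T$, $\tau_i=t_i-t_{i-1}$, the minimizing-movements scheme: $y_0=y^0$ and $$y_i=(q_i,p_i,\theta_i)\in\operatorname*{arg\,min}_{y\in\mathbb R^3}G(\tau_i,y_{i-1};y),\qquad i=1,\dots,N.$$ Then: (a) (Existence) For every partition and every $i$, given $y_{i-1}\in\mathbb R^2\times(0,\infty)$, the functional $G(\tau_i,y_{i-1};\cdot)$ admits a minimizer, and each minimizer has $\theta_i>0$; hence the scheme has a solution $\{y_i\}_{i=0}^N$. (b) (Uniqueness) There is $\tau^*>0$, depending only on $y^0$ and on $m,\nu,\kappa,\lambda,c$, such that if $\max_i\tau_i\le\tau^*$ then the solution of the scheme is unique. (c) Every solution of the scheme satisfies $G(\tau_i,y_{i-1};y_i)\le0$ for $i=1,\dots,N$. (d) (A priori bounds) There exist constants $C>0$ and $\theta_{\min}>0$, independent of the partition, such that every solution $\{y_i\}_{i=0}^N$ of the scheme satisfies $|y_i|\le C$ and $\theta_i\ge\theta_{\min}$ for all $i$, and its interpolations satisfy $\|\widehat y\|_{H^1(0,T;\mathbb R^3)}\le C$, $\|L(\overline y)\,\mathrm DE(\overline y)\|_{L^2(0,T;\mathbb R^3)}\le C$ and $\|\mathrm DS(\overline y)\|_{L^2(0,T;\mathbb R^3)}\le C$. (e) (Convergence) For every sequence of partitions $0=t_0^n<\dots<t_{N^n}^n=T$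 with $\max_i(t_i^n-t_{i-1}^n)\to0$ and every choice of corresponding solutions $\{(q_i^n,p_i^n,\theta_i^n)\}_{i=0}^{N^n}$ of the scheme, the whole sequence of piecewise linear interpolations satisfies $$(\widehat q^{\,n},\widehat p^{\,n},\widehat\theta^{\,n})\rightharpoonup(q,p,\theta)\quad\text{weakly in }H^1(0,T;\mathbb R^3),$$ where $(q,p,\theta)$ is the unique solution on $[0,T]$ of the damped harmonic oscillator system $$q'=\frac pm,\qquad p'=-\frac{\nu p}{m}-\kappa q-\lambda\theta,\qquad\theta'=\frac{\nu p^2}{m^2c}+\frac{\lambda p\,\theta}{mc}$$ with $(q(0),p(0),\theta(0))=(q^0,p^0,\theta^0)$.
   Context: Write $y=(q,p,\theta)$. The total energy and total entropy are $$E(q,p,\theta)=\frac{p^2}{2m}+c\,\theta+\frac{\kappa q^2}{2},\qquad S(q,p,\theta)=-\lambda q+c+c\ln\theta\ \ (\theta>0),$$ with $S=-\infty$ for $\theta\le0$, so that $\mathrm DE(y)=(\kappa q,p/m,c)$ and $\mathrm DS(y)=(-\lambda,0,c/\theta)$. The Poisson and Onsager operators are $$L(y)=\begin{pmatrix}0&1&0\\-1&0&-\lambda\theta/c\\0&\lambda\theta/c&0\end{pmatrix},\qquad K(y)=\nu\theta\begin{pmatrix}0&0&0\\0&1&-p/(mc)\\0&-p/(mc)&p^2/(mc)^2\end{pmatrix}.$$ With $\Psi(y,\xi)=\frac12\xi\cdot K(y)\xi$ and $\Psi^*(y,\cdot)$ its convex conjugate in the second variable, the incremental functional is $G(\tau,\eta;y)=-S(y)+\tau\Psi^*\big(y,\frac{y-\eta}{\tau}-L(y)\mathrm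 DE(y)\big)+\tau\Psi(y,\mathrm DS(y))+S(\eta)$. Explicitly, for $\tau>0$, $\eta=(\eta_q,\eta_p,\eta_\theta)\in\mathbb R^2\times(0,\infty)$ and $y=(q,p,\theta)\in\mathbb R^3$, $$G(\tau,\eta;y)=\lambda q-c\ln\theta+\frac{\tau}{2\nu\theta}\Big(\frac{p-\eta_p}{\tau}+\kappa q+\lambda\theta\Big)^2+\frac{\tau\nu\theta}{2}\Big(\frac{p}{m\theta}\Big)^2-\lambda\eta_q+c\ln\eta_\theta$$ if $\theta>0$, $\frac{q-\eta_q}{\tau}=\frac pm$ and $c\,\frac{\theta-\eta_\theta}{\tau}=-\frac pm\,\frac{p-\eta_p}{\tau}-\frac{\kappa pq}{m}$; and $G(\tau,\eta;y)=\infty$ otherwise. Interpolations: for $\{y_i\}_{i=0}^N$ set $\overline y(0)=\widehat y(0)=y_0$ and, for $t\in(t_{i-1},t_i]$, $\overline y(t)=y_i$ and $\widehat y(t)=\frac{t-t_{i-1}}{\tau_i}y_i+\frac{t_i-t}{\tau_i}y_{i-1}$; $\widehat q,\widehat p,\widehat\theta$ are the components of $\widehat y$. *)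

(* Defs.v *)
From HB Require Import structures.
From mathcomp Require Import all_boot all_order all_algebra.
From mathcomp Require Import all_classical all_reals all_analysis.
Set Implicit Arguments.
Unset Strict Implicit.
Unset Printing Implicit Defensive.
Import Order.TTheory GRing.Theory Num.Theory.
Import numFieldNormedType.Exports.
Local Open Scope classical_set_scope.
Local Open Scope ring_scope.

(* Points y = (q, p, theta) of R^3 are column vectors, so that the operators
   act by matrix multiplication.  The library norm on matrices is the sup
   norm, hence the explicit Euclidean structure. *)
Section Space.
Variable R : realType.

Definition vec3 (a b d : R) : 'cV[R]_3 := \col_(i < 3) [:: a; b; d]`_i.

Definition qof (y : 'cV[R]_3) : R := y 0 0.
Definition pof (y : 'cV[R]_3) : R := y 1 0.
Definition thof (y : 'cV[R]_3) : R := y 2%R 0.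

Definition dot (u v : 'cV[R]_3) : R := \sum_(i < 3) u i 0 * v i 0.
Definition enorm (u : 'cV[R]_3) : R := Num.sqrt (dot u u).

End Space.

Section Oscillator.
Variables (R : realType) (m nu kappa lambda c : R).
Implicit Types y xi zeta eta : 'cV[R]_3.

Definition entropy y : \bar R :=
  if 0 < thof y then (- lambda * qof y + c + c * ln (thof y))%:E else -oo%E.

(* Gradient of the energy p^2 / (2 m) + c theta + kappa q^2 / 2. *)
Definition DE y : 'cV[R]_3 := vec3 (kappa * qof y) (pof y / m) c.

(* Gradient of the entropy, meaningful for thof y > 0 only. *)
Definition DS y : 'cV[R]_3 := vec3 (- lambda) 0 (c / thof y).

Definition Lop y : 'M[R]_3 := \matrix_(i < 3, j < 3)
  (nth [::] [:: [:: 0;  1;                   0];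
                [:: -1; 0;                   - (lambda * thof y / c)];
                [:: 0;  lambda * thof y / c; 0]] i)`_j.

Definition Kop y : 'M[R]_3 := nu * thof y *: \matrix_(i < 3, j < 3)
  (nth [::] [:: [:: 0; 0;                  0];
                [:: 0; 1;                  - (pof y / (m * c))];
                [:: 0; - (pof y / (m * c)); pof y ^+ 2 / (m * c) ^+ 2]] i)`_j.

Definition Psi y xi : R := 2^-1 * dot xi (Kop y *m xi).

Definition Psi_conj y zeta : \bar R :=
  ereal_sup [set (dot zeta xi - Psi y xi)%:E | xi in [set: 'cV[R]_3]].

(* Used with tau > 0 and thof eta > 0.  If thof y <= 0 this is then +oo,
   whatever the junk value of DS y: the term - entropy y is +oo and Psi_conj
   is bounded below by - Psi y 0 = 0. *)
Definition incr (tau : R) eta y : \bar R :=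
  (- entropy y
   + tau%:E * Psi_conj y (tau^-1 *: (y - eta) - Lop y *m DE y)%R
   + (tau * Psi y (DS y))%R%:E
   + entropy eta)%E.

Definition argmin (F : 'cV[R]_3 -> \bar R) : set 'cV[R]_3 :=
  [set y | forall z, (F y <= F z)%E].

(* Only the values of t and y at 0, ..., N matter. *)
Definition is_partition (T : R) (N : nat) (t : nat -> R) :=
  [/\ t 0%N = 0, t N = T & forall i, (i < N)%N -> t i < t i.+1].

Definition mesh (N : nat) (t : nat -> R) : R :=
  \big[Num.max/0]_(i < N) (t i.+1 - t i).

Definition scheme_sol (N : nat) (t : nat -> R) y0 (y : nat -> 'cV[R]_3) :=
  y 0%N = y0 /\
  forall i, (i < N)%N -> argmin (incr (t i.+1 - t i) (y i)) (y i.+1).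

(* On (0, T] this is the index i with t_(i-1) < s <= t_i, and it is 0 at
   s = 0. *)
Definition cell (N : nat) (t : nat -> R) (s : R) : nat :=
  find (fun i => s <= t i) (iota 0 N.+1).

Definition pwconst N t (y : nat -> 'cV[R]_3) (s : R) : 'cV[R]_3 :=
  y (cell N t s).

Definition pwlinear N t (y : nat -> 'cV[R]_3) (s : R) : 'cV[R]_3 :=
  if cell N t s is i.+1
  then ((s - t i) / (t i.+1 - t i)) *: y i.+1
       + ((t i.+1 - s) / (t i.+1 - t i)) *: y i
  else y 0%N.

(* Classical solutions: continuous on [0, T], with the equations holding in
   the open interval (hence up to the end points for one-sided
   derivatives). *)
Definition oscillator_sol (T : R) y0 (y : R -> 'cV[R]_3) :=
  [/\ y 0 = y0,
      {within `[0, T], continuous (fun s => qof (y s))} /\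
      {within `[0, T], continuous (fun s => pof (y s))} /\
      {within `[0, T], continuous (fun s => thof (y s))}
    & forall s, s \in `]0, T[ ->
      [/\ is_derive s 1 (fun s => qof (y s)) (pof (y s) / m),
          is_derive s 1 (fun s => pof (y s))
            (- (nu * pof (y s) / m) - kappa * qof (y s) - lambda * thof (y s))
        & is_derive s 1 (fun s => thof (y s))
            (nu * pof (y s) ^+ 2 / (m ^+ 2 * c)
             + lambda * pof (y s) * thof (y s) / (m * c))]].

End Oscillator.

Section Sobolev.
Variables (R : realType) (T : R).
Implicit Types (u v g : R -> 'cV[R]_3) (phi : R -> R).
Local Notation mu := (@lebesgue_measure R).

(* The norm of L^2(0,T;R^3). *)
Definition L2norm u : \bar R :=
  ('N[mu]_2%:E[EFin \o ((fun s => enorm (u s)) \_ `]0, T[)%R])%E.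

Definition L2 u :=
  (forall i : 'I_3, measurable_fun `]0, T[ (fun s => u s i 0)) /\
  (L2norm u < +oo)%E.

(* phi is in C_c^oo(0,T). *)
Definition test_fun phi :=
  (forall n s, derivable (derive1n n phi) s 1) /\
  exists a b, [/\ 0 < a, b < T & forall s, s \notin `[a, b] -> phi s = 0].

Definition weak_derivative u g :=
  [/\ L2 u, L2 g &
      forall phi, test_fun phi -> forall i : 'I_3,
        \int[mu]_(s in `]0, T[) (u s i 0 * derive1 phi s)
        = - \int[mu]_(s in `]0, T[) (g s i 0 * phi s)].

Definition H1 u := exists g, weak_derivative u g.

(* Weak derivatives are unique up to null sets, so for u in H^1 the infimum
   is over a single value; it is +oo outside H^1. *)
Definition H1norm u : \bar R :=
  ereal_inf [set ((L2norm u `^ 2 + L2norm g `^ 2) `^ 2^-1)%E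
            | g in [set g | weak_derivative u g]].

(* Continuous linear functionals on H^1(0,T;R^3); the values outside H^1 are
   irrelevant, and the bound makes l u depend only on the class of u modulo
   equality almost everywhere. *)
Definition H1_dual (l : (R -> 'cV[R]_3) -> R) :=
  (forall (a : R) u v, H1 u -> H1 v ->
     l (fun s => a *: u s + v s) = a * l u + l v) /\
  exists M : R, forall u, H1 u -> (`|l u|%:E <= M%:E * H1norm u)%E.

Definition weak_cvg_H1 (w : nat -> R -> 'cV[R]_3) u :=
  [/\ forall n, H1 (w n), H1 u &
      forall l, H1_dual l -> l (w n) @[n --> \oo] --> l u].

End Sobolev.

(* Main.v *)
Require Import Defs.
From mathcomp Require Import all_boot all_order all_algebra.
From mathcomp Require Import all_classical all_reals all_analysis.
From mathcomp Require Import measurable_realfun.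
From mathcomp Require Import ring lra.
Set Implicit Arguments.
Unset Strict Implicit.
Unset Printing Implicit Defensive.
Import Order.TTheory GRing.Theory Num.Theory.
Import numFieldNormedType.Exports.
Local Open Scope classical_set_scope.
Local Open Scope ring_scope.

(* Admissible competitors of a step from [eta] form a curve parametrized by the
   momentum.  On it the energy does not exceed that of [eta], and completing the
   square turns the incremental functional into
     c (ln (th_eta / th) + 1 - th_eta / th) + tau r^2 / (2 nu th),
   where r is the momentum residual of the implicit Euler scheme.  An implicit
   Euler step exists (intermediate value theorem) and has a nonpositive value,
   so minimizers satisfy r^2 = O(tau): the scheme is implicit Euler up to an
   error of order the square root of the mesh.  Energy decay and entropy growth
   give the uniform bounds; the logarithm makes the functional strictly convex
   along the curve for small tau.
   Two approximate solutions of a Lipschitz equation are close by a discrete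
   Gronwall estimate.  Hence the interpolations are uniformly Cauchy and their
   limit is the unique solution of the oscillator; their slopes then converge
   uniformly as well, so the convergence is strong in H^1. *)

(** The square-root rate comes from a circularity. Comparison with the implicit Euler step only
    tells that the value of a minimizer is nonpositive. This bounds tau r^2 by the squared
    temperature increment, which itself contains tau r. For small tau that term is absorbed and r^2
    = O(tau) remains; for large tau a crude bound on r is enough, so the estimates hold for every
    partition. The vector field is quadratic, hence Lipschitz only on balls, and bounds must precede
    any comparison. Approximate solutions are described by one-step increments alone, with neither
    derivatives nor integrals, so that interpolations and classical solutions fall under the same
    distance estimate; it yields the rate of convergence, the existence of the solution up to time T
    and its uniqueness. Measure theory enters only at the end, where uniform bounds on a piecewise
    C^1 function and on its derivative become a bound in H^1. *)

Section Vec.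
Variable R : realType.
Implicit Types (u v y : 'cV[R]_3) (a b d : R).

Lemma qof_vec3 a b d : qof (vec3 a b d) = a.
Proof. by rewrite /qof mxE. Qed.
Lemma pof_vec3 a b d : pof (vec3 a b d) = b.
Proof. by rewrite /pof mxE. Qed.
Lemma thof_vec3 a b d : thof (vec3 a b d) = d.
Proof. by rewrite /thof mxE. Qed.
Definition vec3E := (qof_vec3, pof_vec3, thof_vec3).

Lemma ord3P (P : 'I_3 -> Prop) : P 0 -> P 1 -> P 2%R -> forall i, P i.
Proof.
move=> P0 P1 P2 [[|[|[|//]]] Hi].
- by rewrite (_ : Ordinal Hi = 0)//; apply/val_inj.
- by rewrite (_ : Ordinal Hi = 1)//; apply/val_inj.
- by rewrite (_ : Ordinal Hi = 2%R)//; apply/val_inj.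
Qed.

Lemma vec3P u v : qof u = qof v -> pof u = pof v -> thof u = thof v -> u = v.
Proof.
move=> h0 h1 h2; apply/matrixP => i j; rewrite ord1.
by move: i; apply: ord3P.
Qed.

Lemma sum3 (f : 'I_3 -> R) : \sum_(i < 3) f i = f 0 + f 1 + f 2%R.
Proof.
rewrite !big_ord_recl big_ord0 addr0 addrA.
by congr (_ + f _ + f _); apply/val_inj.
Qed.

Lemma dotE u v : dot u v = qof u * qof v + pof u * pof v + thof u * thof v.
Proof. by rewrite /dot sum3. Qed.

Lemma dotZr u v (k : R) : dot u (k *: v) = k * dot u v.
Proof. by rewrite !dotE /qof /pof /thof !mxE; ring. Qed.

Lemma qofD u v : qof (u + v) = qof u + qof v. Proof. by rewrite /qof mxE. Qed.
Lemma pofD u v : pof (u + v) = pof u + pof v. Proof. by rewrite /pof mxE. Qed.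
Lemma thofD u v : thof (u + v) = thof u + thof v. Proof. by rewrite /thof mxE. Qed.
Lemma qofN u : qof (- u) = - qof u. Proof. by rewrite /qof mxE. Qed.
Lemma pofN u : pof (- u) = - pof u. Proof. by rewrite /pof mxE. Qed.
Lemma thofN u : thof (- u) = - thof u. Proof. by rewrite /thof mxE. Qed.
Lemma qofZ a u : qof (a *: u) = a * qof u. Proof. by rewrite /qof mxE. Qed.
Lemma pofZ a u : pof (a *: u) = a * pof u. Proof. by rewrite /pof mxE. Qed.
Lemma thofZ a u : thof (a *: u) = a * thof u. Proof. by rewrite /thof mxE. Qed.
Definition compE := (qofD, pofD, thofD, qofN, pofN, thofN, qofZ, pofZ, thofZ).

End Vec.

(** * The incremental functional *)

Section Incr.
Variables (R : realType) (m nu kappa lambda c : R).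
Hypotheses (m_gt0 : 0 < m) (nu_gt0 : 0 < nu) (kappa_gt0 : 0 < kappa)
    (lambda_gt0 : 0 < lambda) (c_gt0 : 0 < c).
Implicit Types (y xi zeta eta : 'cV[R]_3) (tau : R).

(** [Kop y] is [nu * thof y] times the rank-one matrix w w^T with w = (0, 1, -p/(mc)), so the
    potential is a single square. Its null directions (1, 0, 0) and (0, p/(mc), 1) are the origin of
    the two constraints on competitors. *)
Lemma PsiE y xi : Psi m nu c y xi =
  nu * thof y / 2 * (pof xi - pof y / (m * c) * thof xi) ^+ 2.
Proof.
rewrite /Psi dotE.
rewrite /qof /pof /thof !mxE !sum3 !mxE /=.
have := lt0r_neq0 m_gt0; have := lt0r_neq0 c_gt0 => ? ?.
by rewrite /thof /pof; field; apply/andP.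
Qed.

Lemma LopDE y : Lop lambda c y *m DE m kappa c y =
  vec3 (pof y / m) (- (kappa * qof y) - lambda * thof y)
       (lambda * thof y * pof y / (m * c)).
Proof.
have := lt0r_neq0 m_gt0; have := lt0r_neq0 c_gt0 => ? ?.
by apply: vec3P; rewrite vec3E /qof /pof /thof !mxE !sum3 !mxE /= /qof /pof /thof; field;
  rewrite ?m0 ?c0//; apply/andP.
Qed.

Lemma Psi_conj_ge y zeta xi :
  ((dot zeta xi - Psi m nu c y xi)%:E <= Psi_conj m nu c y zeta)%E.
Proof. by apply: ereal_sup_ubound; exists xi. Qed.

Lemma Psi_conj_ge0 y zeta : (0 <= Psi_conj m nu c y zeta)%E.
Proof.
apply: le_trans (Psi_conj_ge y zeta 0).
by rewrite PsiE dotE /qof /pof /thof !mxE !mulr0 !addr0 subr0 expr0n /= mulr0 subr0.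
Qed.

(** The two equations put [zeta] in the span of (0, 1, -p/(mc)), the range of [Kop y]. The quantity
    under the supremum then depends on [xi] only through the number [s] of the proof, as a concave
    parabola. *)
Lemma Psi_conj_fin y zeta : 0 < thof y -> qof zeta = 0 ->
  thof zeta = - (pof y / (m * c) * pof zeta) ->
  Psi_conj m nu c y zeta = (pof zeta ^+ 2 / (2 * nu * thof y))%:E.
Proof.
move=> th0 zq zth; have nth0 : 0 < nu * thof y by rewrite mulr_gt0.
have := lt0r_neq0 nu_gt0; have := lt0r_neq0 th0 => th_neq0 nu_neq0.
apply/eqP; rewrite eq_le; apply/andP; split.
  apply: ge_ereal_sup => _ [xi _ <-]; rewrite lee_fin PsiE dotE zq zth.
  rewrite ler_pdivlMr; last by rewrite -mulrA mulr_gt0.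
  rewrite -subr_ge0.
  set s := pof xi - _ * _.
  rewrite (_ : _ - _ = (pof zeta - nu * thof y * s) ^+ 2) ?sqr_ge0//.
  by rewrite /s; field; rewrite !lt0r_neq0.
(* This [xi] realizes the vertex of the parabola, [s = pof zeta / (nu * thof y)]. *)
apply: le_trans (Psi_conj_ge y zeta (vec3 0 (pof zeta / (nu * thof y)) 0)).
rewrite lee_fin PsiE dotE !vec3E !mulr0 subr0 addr0 add0r.
rewrite le_eqVlt; apply/orP; left; apply/eqP; field.
by rewrite nu_neq0 th_neq0.
Qed.

Lemma PsiZ y xi (k : R) : Psi m nu c y (k *: xi) = k ^+ 2 * Psi m nu c y xi.
Proof. by rewrite !PsiE !compE; ring. Qed.

(** Along the multiples of a null direction of the potential only the linear term survives, and it
    takes every real value. *)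
Lemma Psi_conj_pinfty y zeta xi : Psi m nu c y xi = 0 -> dot zeta xi != 0 ->
  Psi_conj m nu c y zeta = +oo%E.
Proof.
move=> xi0 d0; apply/eqyP => A A0; apply: le_trans (Psi_conj_ge y zeta ((A / dot zeta xi) *: xi)).
rewrite PsiZ xi0 mulr0.
rewrite subr0 lee_fin (_ : dot zeta _ = A / dot zeta xi * dot zeta xi) ?dotZr ?divfK//.
Qed.

(** The domain where the functional is finite: the argument of [Psi_conj] is orthogonal to both null
    directions of [Kop y], solved for q and theta. Together the two equations make [DE y] orthogonal
    to [y - eta]. *)
Definition admissible tau eta y : Prop :=
  [/\ 0 < thof y, qof y = qof eta + tau * pof y / m &
      thof y = thof eta - pof y / (m * c) * (pof y - pof eta + tau * kappa * qof y)].

Definition incr_val tau eta y : R :=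
  lambda * (qof y - qof eta) - c * ln (thof y) + c * ln (thof eta)
  + tau / (2 * nu * thof y)
    * ((pof y - pof eta) / tau + kappa * qof y + lambda * thof y) ^+ 2
  + tau * nu * pof y ^+ 2 / (2 * m ^+ 2 * thof y).

(** The argument of [Psi_conj] in [incr]: the discrete velocity minus its reversible part. *)
Definition force_z tau eta y : 'cV[R]_3 :=
  tau^-1 *: (y - eta) - Lop lambda c y *m DE m kappa c y.

Lemma force_zE tau eta y : force_z tau eta y =
  vec3 ((qof y - qof eta) / tau - pof y / m)
       ((pof y - pof eta) / tau + kappa * qof y + lambda * thof y)
       ((thof y - thof eta) / tau - lambda * thof y * pof y / (m * c)).
Proof.
by rewrite /force_z LopDE; apply: vec3P; rewrite !compE !vec3E; ring.
Qed.

Lemma incr_fin tau eta y : 0 < tau -> 0 < thof eta -> admissible tau eta y ->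
  incr m nu kappa lambda c tau eta y = (incr_val tau eta y)%:E.
Proof.
move=> t0 e0 [y0 hq hth].
have tn := lt0r_neq0 t0; have mn := lt0r_neq0 m_gt0; have cn := lt0r_neq0 c_gt0.
have nn := lt0r_neq0 nu_gt0; have yn := lt0r_neq0 y0.
rewrite /incr /entropy y0 e0 -/(force_z tau eta y) force_zE Psi_conj_fin//; last 2 first.
- by rewrite vec3E hq; field; apply/andP.
- by rewrite !vec3E hth; field; rewrite mn cn tn.
rewrite vec3E PsiE !vec3E -!(EFinN, EFinM, EFinD); congr (_%:E).
by rewrite /incr_val; field; rewrite mn cn tn yn nn.
Qed.

(** For theta <= 0 the entropy term is infinite and the dissipation nonnegative. For theta > 0, if
    both null directions of [Kop y] were orthogonal to [force_z], then [y] would be admissible; so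
    one of them makes the conjugate infinite. *)
Lemma incr_pinfty tau eta y : 0 < tau -> 0 < thof eta -> ~ admissible tau eta y ->
  incr m nu kappa lambda c tau eta y = +oo%E.
Proof.
move=> t0 e0 nadm.
have tn := lt0r_neq0 t0; have mn := lt0r_neq0 m_gt0; have cn := lt0r_neq0 c_gt0.
have pos := Psi_conj_ge0 y (force_z tau eta y).
rewrite /incr /entropy e0 -/(force_z tau eta y).
case: ltP => [y0|y0]; last first.
  have : (0 <= tau%:E * Psi_conj m nu c y (force_z tau eta y))%E.
    by rewrite mule_ge0// lee_fin ltW.
  by move: (tau%:E * _)%E => [s||].
suff -> : Psi_conj m nu c y (force_z tau eta y) = +oo%E.
  by rewrite gt0_muley// lte_fin.
have [zq|zq] := eqVneq (qof (force_z tau eta y)) 0; last first.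
  apply: (@Psi_conj_pinfty _ _ (vec3 1 0 0)).
    by rewrite PsiE !vec3E mulr0 subr0 expr0n mulr0.
  by rewrite dotE !vec3E mulr1 !mulr0 !addr0.
apply: (@Psi_conj_pinfty _ _ (vec3 0 (pof y / (m * c)) 1)).
  by rewrite PsiE !vec3E mulr1 subrr expr0n mulr0.
apply/eqP => zt; apply: nadm; split => //.
  move: zq; rewrite force_zE vec3E => /eqP; rewrite subr_eq0 => /eqP zq.
  by rewrite -mulrA -zq; field.
move: zt; rewrite dotE force_zE !vec3E mulr0 add0r => zt.
apply/eqP; rewrite -subr_eq0; apply/eqP.
rewrite -[RHS](mulr0 tau) -zt; field.
by rewrite mn cn tn.
Qed.

(** Without an admissible competitor the functional would be constantly [+oo] and every point a
    minimizer, hence the third hypothesis. *)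
Lemma argminP tau eta y : 0 < tau -> 0 < thof eta ->
  (exists z, admissible tau eta z) ->
  argmin (incr m nu kappa lambda c tau eta) y <->
  admissible tau eta y /\
  forall z, admissible tau eta z -> incr_val tau eta y <= incr_val tau eta z.
Proof.
move=> t0 e0 [z0 az0]; split=> [ymin|[ay ymin] z].
  have ay : admissible tau eta y.
    apply: contrapT => nay; have := ymin z0.
    by rewrite incr_pinfty// incr_fin.
  by split=> // z az; have := ymin z; rewrite !incr_fin.
have [az|naz] := pselect (admissible tau eta z).
  by rewrite !incr_fin// lee_fin ymin.
by rewrite (incr_pinfty t0 e0 naz)// leey.
Qed.

Definition residual tau eta y : R :=
  (pof y - pof eta) / tau + kappa * qof y + lambda * thof y + nu * pof y / m.

(* The dissipation terms are a completed square around the implicit Euler step,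
   up to an exact expression of the entropy production. *)
Lemma incr_valE tau eta y : 0 < tau -> admissible tau eta y ->
  incr_val tau eta y = c * (ln (thof eta) - ln (thof y) + 1 - thof eta / thof y)
    + tau * residual tau eta y ^+ 2 / (2 * nu * thof y).
Proof.
move=> t0 [y0 hq hth].
have tn := lt0r_neq0 t0; have mn := lt0r_neq0 m_gt0; have cn := lt0r_neq0 c_gt0.
have nn := lt0r_neq0 nu_gt0; have yn := lt0r_neq0 y0.
rewrite /incr_val /residual; set l1 := ln (thof y); set l2 := ln (thof eta).
have -> : thof eta = thof y + pof y / (m * c) * (pof y - pof eta + tau * kappa * qof y).
  by rewrite hth subrK.
have -> : qof y - qof eta = tau * pof y / m by rewrite hq addrC addKr.
by field; rewrite mn cn tn nn yn.
Qed.

End Incr.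

Lemma continuous_quadratic (R : realType) (k2 k1 k0 : R) (f : R -> R) :
  (forall x, f x = k2 * (x * x) + k1 * x + k0) -> continuous f.
Proof.
move=> fE; have -> : f = fun x => k2 * (x * x) + k1 * x + k0 by exact/funext.
move=> x; apply: cvgD; last exact: cvg_cst.
apply: cvgD; apply: cvgM; [exact: cvg_cst| |exact: cvg_cst|exact: cvg_id].
by apply: cvgM; exact: cvg_id.
Qed.

(** * One step of the scheme: existence, uniqueness and estimates of minimizers *)

Section Step.
Variables (R : realType) (m nu kappa lambda c : R).
Hypotheses (m_gt0 : 0 < m) (nu_gt0 : 0 < nu) (kappa_gt0 : 0 < kappa)
    (lambda_gt0 : 0 < lambda) (c_gt0 : 0 < c).
Implicit Types (y z eta : 'cV[R]_3) (tau p : R).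
Let mn := lt0r_neq0 m_gt0.
Let nn := lt0r_neq0 nu_gt0.
Let cn := lt0r_neq0 c_gt0.
Local Notation admissible := (admissible m kappa c).
Local Notation incr_val := (incr_val m nu kappa lambda c).
Local Notation residual := (residual m nu kappa lambda).
Local Notation incr := (incr m nu kappa lambda c).

Let minP tau eta y := @argminP _ _ _ kappa lambda _ m_gt0 nu_gt0 c_gt0 tau eta y.

Definition energy y := pof y ^+ 2 / (2 * m) + c * thof y + kappa * qof y ^+ 2 / 2.

(** Since [DE y] is orthogonal to [y - eta], the energy lost is exactly the second-order remainder
    of the kinetic and elastic energies, which is nonnegative by convexity. *)
Lemma energy_le tau eta y : admissible tau eta y -> energy y <= energy eta.
Proof.
move=> [_ hq hth]; rewrite /energy -subr_ge0.
have -> : thof eta = thof y + pof y / (m * c) * (pof y - pof eta + tau * kappa * qof y).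
  by rewrite hth subrK.
rewrite (_ : _ - _ = (pof y - pof eta) ^+ 2 / (2 * m) + kappa * (qof y - qof eta) ^+ 2 / 2).
  have m2 : 0 <= 2 * m by rewrite mulr_ge0// ltW.
  by apply: addr_ge0; rewrite divr_ge0 ?sqr_ge0// mulr_ge0 ?sqr_ge0// ltW.
by rewrite hq; field; rewrite mn cn.
Qed.

Lemma pof_energy y : 0 < thof y -> pof y ^+ 2 <= 2 * m * energy y.
Proof.
move=> y0; rewrite /energy mulrDr mulrDr.
rewrite [X in X + _ + _](_ : _ = pof y ^+ 2); last by field.
have h : 0 < m * c * thof y by rewrite !mulr_gt0.
have h' : 0 <= m * kappa * qof y ^+ 2 by rewrite mulr_ge0 ?sqr_ge0// mulr_ge0// ltW.
by lra.
Qed.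

Lemma thof_energy y : c * thof y <= energy y.
Proof.
rewrite /energy addrAC lerDr addr_ge0// divr_ge0//.
- by rewrite sqr_ge0.
- by rewrite mulr_ge0 ?ltW.
- by rewrite mulr_ge0 ?sqr_ge0 ?ltW.
Qed.

Lemma qof_energy y : 0 < thof y -> kappa * qof y ^+ 2 <= 2 * energy y.
Proof.
move=> y0; have h : 0 < c * thof y by rewrite mulr_gt0.
have h' : 0 <= pof y ^+ 2 / (2 * m) by rewrite divr_ge0 ?sqr_ge0// mulr_ge0// ltW.
by rewrite /energy; lra.
Qed.

(** Substituting the equation for q turns p - p_eta + tau kappa q into a p - b, with a and b given
    here and in [curve_b]. The temperature is therefore a strictly concave quadratic function of p
    along the curve. *)
Definition curve_a tau := 1 + tau ^+ 2 * kappa / m.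
Definition curve_b tau eta := pof eta - tau * kappa * qof eta.
Definition curve_th tau eta p :=
  thof eta - p / (m * c) * (curve_a tau * p - curve_b tau eta).
Definition curve tau eta p : 'cV[R]_3 :=
  vec3 (qof eta + tau * p / m) p (curve_th tau eta p).

Lemma curve_a_gt0 tau : 0 < curve_a tau.
Proof.
by rewrite /curve_a ltr_pwDl// divr_ge0 ?(ltW m_gt0)// mulr_ge0 ?sqr_ge0// ltW.
Qed.

Lemma curve_adm tau eta p : 0 < curve_th tau eta p -> admissible tau eta (curve tau eta p).
Proof.
move=> h; split; rewrite !vec3E// /curve_th /curve_a /curve_b.
by field; rewrite mn cn.
Qed.

Lemma adm_curve tau eta y : admissible tau eta y -> y = curve tau eta (pof y).
Proof.
move=> [y0 hq hth]; apply: vec3P; rewrite vec3E// hth hq.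
by rewrite /curve_th /curve_a /curve_b; field; rewrite mn cn.
Qed.

Lemma curve_th0 tau eta : curve_th tau eta 0 = thof eta.
Proof. by rewrite /curve_th !mul0r subr0. Qed.

Lemma ln_sub_le (x y : R) : 0 < x -> 0 < y -> ln x - ln y <= x / y - 1.
Proof.
move=> x0 y0; rewrite -ln_div ?posrE//.
have xy0 : 0 < x / y by rewrite divr_gt0.
have := @le_ln1Dx R (x / y - 1); rewrite [1 + _]addrC subrK; apply.
by rewrite ltrBrDr addNr.
Qed.

(** The temperature parabola is positive between its roots p1 < 0 < p2. At the roots the temperature
    term of the residual vanishes and what is left has opposite signs, so the residual has a zero
    strictly in between. *)
Lemma implicit_Euler_step tau eta : 0 < tau -> 0 < thof eta ->
  exists2 y, admissible tau eta y & residual tau eta y = 0.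
Proof.
move=> t0 e0.
have a0 := curve_a_gt0 tau.
set a := curve_a tau in a0; set b := curve_b tau eta.
have an := lt0r_neq0 a0.
(* Discriminant of a p^2 - b p - m c theta_eta, whose roots are the zeros of the temperature on the
   curve. *)
set D := b ^+ 2 + 4 * a * (m * c * thof eta).
have mce0 : 0 < 4 * a * (m * c * thof eta) by rewrite !mulr_gt0.
have D0 : 0 <= D by rewrite addr_ge0 ?sqr_ge0// ltW.
set s := Num.sqrt D.
have s2 : s ^+ 2 = D by rewrite sqr_sqrtr.
have s0 : 0 <= s by exact: sqrtr_ge0.
have bs : `|b| < s.
  by rewrite -sqrtr_sqr ltr_sqrt// /D ?ltrDl// ltr_wpDl ?sqr_ge0.
have /andP[bs1 bs2] : - s < b < s by rewrite -ltr_norml.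
pose p1 := (b - s) / (2 * a); pose p2 := (b + s) / (2 * a).
have thE p : curve_th tau eta p = - (a / (m * c)) * (p - p1) * (p - p2).
  rewrite /curve_th -/a -/b /p1 /p2.
  have -> : thof eta = (s ^+ 2 - b ^+ 2) / (4 * a * m * c).
    by rewrite s2 /D; field; rewrite an mn cn.
  by field; rewrite mn cn an.
have p10 : p1 < 0.
  by rewrite /p1 pmulr_llt0 ?invr_gt0 ?mulr_gt0// subr_lt0.
have p20 : 0 < p2.
  by rewrite /p2 pmulr_lgt0 ?invr_gt0 ?mulr_gt0// -(opprK s) -ltrBlDr sub0r opprK.
(* [tau] times the residual at the point of the curve with momentum [p]. *)
pose f p := a * p - b + tau * lambda * curve_th tau eta p + tau * nu * p / m.
have f1 : f p1 < 0.
  rewrite /f thE subrr mulr0 mul0r mulr0 addr0.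
  have -> : a * p1 - b = (- b - s) / 2 by rewrite /p1; field.
  have : tau * nu * p1 / m < 0.
    by rewrite pmulr_llt0 ?invr_gt0// pmulr_rlt0// mulr_gt0.
  by lra.
have f2 : 0 < f p2.
  rewrite /f thE subrr mulr0 mulr0 addr0.
  have -> : a * p2 - b = (s - b) / 2 by rewrite /p2; field.
  have : 0 < tau * nu * p2 / m by rewrite divr_gt0// mulr_gt0 ?p20// mulr_gt0.
  by lra.
have cf : {within `[p1, p2], continuous f}.
  apply: continuous_subspaceT => p.
  move: p; apply: (@continuous_quadratic _ (- (tau * lambda * a / (m * c)))
    (a + tau * lambda * b / (m * c) + tau * nu / m) (tau * lambda * thof eta - b)) => p.
  by rewrite /f /curve_th -/a -/b; ring.
have [||p pin fp] := @IVT R f p1 p2 0 _ cf.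
- by rewrite ltW// (lt_trans p10).
- by rewrite (min_idPl _) ?(max_idPr _) ?ltW// (lt_trans f1).
(* The temperature is zero at both end points, so the zero of [f] must be kept away from them. *)
have pn1 : p != p1 by apply/eqP => e; move: f1; rewrite -e fp ltxx.
have pn2 : p != p2 by apply/eqP => e; move: f2; rewrite -e fp ltxx.
move: pin; rewrite in_itv /= => /andP[pl pr].
have pos : 0 < curve_th tau eta p.
  rewrite thE mulNr mulNr -mulrN opprB; apply: mulr_gt0; first apply: mulr_gt0.
  - by rewrite divr_gt0// mulr_gt0.
  - by rewrite subr_gt0 lt_neqAle eq_sym pn1.
  - by rewrite subr_gt0 lt_neqAle pn2.
exists (curve tau eta p); first exact: curve_adm.
rewrite /residual !vec3E -[RHS](mul0r tau^-1) -fp /f /a /b /curve_a /curve_b.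
by field; rewrite mn lt0r_neq0.
Qed.

Lemma incr_val_le0 tau eta y : 0 < tau -> 0 < thof eta ->
  argmin (incr tau eta) y -> incr_val tau eta y <= 0.
Proof.
move=> t0 e0; have [z az rz] := implicit_Euler_step t0 e0.
case/(minP _ t0 e0 (ex_intro _ z az)) => _ /(_ z az) /le_trans; apply.
rewrite incr_valE// rz expr0n mulr0 mul0r addr0.
have [z0 _ _] := az.
rewrite pmulr_rle0//.
have := ln_sub_le e0 z0; lra.
Qed.

Lemma argmin_adm tau eta y : 0 < tau -> 0 < thof eta ->
  argmin (incr tau eta) y -> admissible tau eta y.
Proof.
move=> t0 e0; have [z az rz] := implicit_Euler_step t0 e0.
by case/(minP _ t0 e0 (ex_intro _ z az)).
Qed.

(** The lower bound is S(eta) - S(y), left after dropping the two nonnegative dissipation terms. It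
    serves twice: for the growth of the entropy along minimizers and for the blow-up of the
    functional as theta tends to 0. *)
Lemma incr_val_ge tau eta y : 0 < tau -> 0 < thof y ->
  lambda * (qof y - qof eta) - c * ln (thof y) + c * ln (thof eta) <= incr_val tau eta y.
Proof.
move=> t0 y0; rewrite /incr_val -[X in _ <= X]addrA lerDl.
have k1 : 0 < 2 * nu * thof y by rewrite !mulr_gt0.
have k2 : 0 < 2 * m ^+ 2 * thof y by rewrite mulr_gt0// mulr_gt0// exprn_gt0.
apply: addr_ge0; first by rewrite mulr_ge0 ?sqr_ge0// divr_ge0// ltW.
by rewrite divr_ge0 ?(ltW k2)// mulr_ge0 ?sqr_ge0// mulr_ge0// ltW.
Qed.

Lemma entropy_increase tau eta y : 0 < tau -> 0 < thof eta ->
  argmin (incr tau eta) y ->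
  - lambda * qof eta + c * ln (thof eta) <= - lambda * qof y + c * ln (thof y).
Proof.
move=> t0 e0 ymin; have [y0 _ _] := argmin_adm t0 e0 ymin.
have := le_trans (incr_val_ge eta t0 y0) (incr_val_le0 t0 e0 ymin); lra.
Qed.

(** A second use of the tangent bound on the logarithm turns the entropy defect into c
    (theta_eta/theta + theta/theta_eta - 2), which is quadratic in the temperature increment. This
    second-order smallness is what makes the residual small. *)
Lemma residual_bound tau eta y : 0 < tau -> 0 < thof eta ->
  argmin (incr tau eta) y ->
  tau * residual tau eta y ^+ 2 * thof eta <= 2 * nu * c * (thof y - thof eta) ^+ 2.
Proof.
move=> t0 e0 ymin; have ay := argmin_adm t0 e0 ymin.
have [y0 _ _] := ay.
have := incr_val_le0 t0 e0 ymin; rewrite incr_valE//.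
set r := residual _ _ _ => h.
have h1 := ln_sub_le y0 e0.
have {h1}h2 : tau * r ^+ 2 / (2 * nu * thof y) <=
    c * (thof eta / thof y + thof y / thof eta - 2).
  have : c * (ln (thof y) - ln (thof eta)) <= c * (thof y / thof eta - 1).
    by rewrite ler_pM2l.
  by lra.
have k0 : 0 < 2 * nu * thof y * thof eta by rewrite !mulr_gt0.
move: h2; rewrite -(ler_pM2r k0).
have yn := lt0r_neq0 y0; have en := lt0r_neq0 e0.
have -> : tau * r ^+ 2 / (2 * nu * thof y) * (2 * nu * thof y * thof eta) =
  tau * r ^+ 2 * thof eta by field; rewrite yn nn.
have -> // : c * (thof eta / thof y + thof y / thof eta - 2) * (2 * nu * thof y * thof eta)
  = 2 * nu * c * (thof y - thof eta) ^+ 2.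
by field; rewrite yn en.
Qed.

(* The functional blows up as the temperature tends to 0 along the admissible
   curve, so that minimizers are sought on a compact piece of the curve. *)
Lemma argmin_exists tau eta : 0 < tau -> 0 < thof eta ->
  argmin (incr tau eta) !=set0.
Proof.
move=> t0 e0.
pose P := Num.sqrt (2 * m * energy eta).
have pP y : admissible tau eta y -> `|pof y| <= P.
  move=> ay; rewrite -sqrtr_sqr ler_wsqrtr//.
  have [y0 _ _] := ay.
  apply: le_trans (pof_energy y0) _.
  by rewrite ler_pM2l ?mulr_gt0// (energy_le ay).
pose th := curve_th tau eta; pose V p := incr_val tau eta (curve tau eta p).
have th00 : th 0 = thof eta by rewrite /th curve_th0.
(* Below the temperature [e] the bound of [incr_val_ge] exceeds [V 0], even with p replaced by its
   least possible value [- P]. *)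
pose e := expR (- (V 0 + lambda * tau * P / m - c * ln (thof eta)) / c).
have big p : 0 < th p -> th p < e -> V 0 < V p.
  move=> thp pe.
  have ac := curve_adm thp.
  have /(incr_val_ge eta t0) : 0 < thof (curve tau eta p) by rewrite vec3E.
  apply: lt_le_trans; rewrite !vec3E.
  have : ln (th p) < ln e by rewrite ltr_ln// posrE expR_gt0.
  rewrite /e expRK => h.
  have {h} : c * ln (th p) < - (V 0 + lambda * tau * P / m - c * ln (thof eta)).
    by rewrite mulrC -ltr_pdivlMr.
  have := pP _ ac; rewrite vec3E ler_norml => /andP[Pp _].
  have : lambda * tau / m * - P <= lambda * tau / m * p.
    by rewrite ler_pM2l// divr_gt0// mulr_gt0.
  by rewrite (_ : lambda * (_ - _) = lambda * tau / m * p); [lra|ring].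
(* The minimum with [thof eta] keeps p = 0 in the compact set [A]. *)
pose d := Num.min e (thof eta).
have d0 : 0 < d by rewrite lt_min expR_gt0.
pose A := [set p : R | d <= th p].
have A0 : A 0 by rewrite /A /= th00 /d ge_min lexx orbT.
have thc : continuous th.
  apply: (@continuous_quadratic _ (- (curve_a tau / (m * c)))
    (curve_b tau eta / (m * c)) (thof eta)) => p.
  by rewrite /th /curve_th; ring.
have Apos p : A p -> 0 < th p by exact: lt_le_trans.
have cA : compact A.
  apply: (@subclosed_compact _ A `[- P, P]%classic).
  - have -> : A = th @^-1` [set x | d <= x] by [].
    by apply: closed_comp => [p _|]; [exact: thc|exact: closed_ge].
  - exact: segment_compact.
  - move=> p /Apos pp /=; rewrite in_itv /= -ler_norml.
    by have := pP _ (curve_adm pp); rewrite vec3E.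
have cV : {within A, continuous V}.
  apply: continuous_in_subspaceT => p; rewrite inE => /Apos thp.
  have thn := lt0r_neq0 thp.
  pose Q p := lambda * tau / m * p + c * ln (thof eta).
  pose W p := (p - pof eta) / tau + kappa * (qof eta + tau * p / m) + lambda * th p.
  have -> : V = fun p => Q p - c * ln (th p) + tau / (2 * nu) * (th p)^-1 * (W p * W p)
      + tau * nu / (2 * m ^+ 2) * (p * p) * (th p)^-1.
    apply/funext => x; rewrite /V /incr_val !vec3E -/th /Q /W.
    by rewrite !invfM; ring.
  have cQ : continuous Q.
    by apply: (@continuous_quadratic _ 0 (lambda * tau / m) (c * ln (thof eta))) => x;
      rewrite mul0r add0r.
  have cW : continuous W.
    apply: (@continuous_quadratic _ (- (lambda * (curve_a tau / (m * c))))
      (tau^-1 + kappa * tau / m + lambda * (curve_b tau eta / (m * c)))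
      (lambda * thof eta - pof eta / tau + kappa * qof eta)) => x.
    by rewrite /W /th /curve_th; ring.
  have cV' : (th x)^-1 @[x --> p] --> (th p)^-1 by apply: cvgV => //; exact: thc.
  apply: cvgD; first apply: cvgD; first apply: cvgD.
  - exact: cQ.
  - apply: cvgN; apply: cvgM; first exact: cvg_cst.
    exact: (continuous_comp (thc p) (continuous_ln thp)).
  - apply: cvgM; last by apply: cvgM; exact: cW.
    by apply: cvgM => //; exact: cvg_cst.
  - apply: cvgM => //; apply: cvgM; first exact: cvg_cst.
    by apply: cvgM; exact: cvg_id.
have [p pA pmin] := compact_EVT_min (ex_intro _ 0 A0) cA cV.
move: pA; rewrite inE => pA.
exists (curve tau eta p); apply/minP => //.
  by exists (curve tau eta 0); apply: curve_adm; rewrite curve_th0.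
split; first by apply: curve_adm; exact: Apos.
move=> z az; rewrite (adm_curve az) -!/(V _).
have [z0 _ _] := az.
have thz : th (pof z) = thof z by rewrite [in RHS](adm_curve az) vec3E.
have [dz|zd] := leP d (th (pof z)); first by apply: pmin; rewrite inE.
apply: le_trans (pmin 0 _) _; first by rewrite inE.
by apply/ltW/big; rewrite ?thz// -thz (lt_le_trans zd)// /d ge_min lexx.
Qed.

(** The function u^2/t is jointly convex and decreasing in t. The inequality between the mean and
    [t3] is there for the temperature, which is concave along the curve. *)
Lemma sqr_over_midpoint_le (u1 u2 t1 t2 t3 : R) : 0 < t1 -> 0 < t2 ->
  (t1 + t2) / 2 <= t3 ->
  ((u1 + u2) / 2) ^+ 2 / t3 <= (u1 ^+ 2 / t1 + u2 ^+ 2 / t2) / 2.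
Proof.
move=> t10 t20 t12.
have ta0 : 0 < (t1 + t2) / 2 by rewrite divr_gt0// addr_gt0.
have t30 := lt_le_trans ta0 t12.
apply: (@le_trans _ _ (((u1 + u2) / 2) ^+ 2 / ((t1 + t2) / 2))).
  by rewrite ler_wpM2l ?sqr_ge0// lef_pV2 ?posrE.
rewrite -subr_ge0.
have -> : (u1 ^+ 2 / t1 + u2 ^+ 2 / t2) / 2 - ((u1 + u2) / 2) ^+ 2 / ((t1 + t2) / 2)
   = (u1 * t2 - u2 * t1) ^+ 2 / (2 * t1 * t2 * (t1 + t2)).
  by field; rewrite ?lt0r_neq0 ?addr_gt0.
by rewrite divr_ge0 ?sqr_ge0// ltW// mulr_gt0 ?addr_gt0// mulr_gt0// mulr_gt0.
Qed.

Lemma ln_midpoint_ge (t1 t2 : R) : 0 < t1 -> 0 < t2 ->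
  (ln t1 + ln t2) / 2 <= ln ((t1 + t2) / 2).
Proof.
move=> t10 t20; have ta0 : 0 < (t1 + t2) / 2 by rewrite divr_gt0// addr_gt0.
have h1 := ln_sub_le t10 ta0; have h2 := ln_sub_le t20 ta0.
have : t1 / ((t1 + t2) / 2) + t2 / ((t1 + t2) / 2) = 2.
  by field; rewrite lt0r_neq0// addr_gt0.
lra.
Qed.

(** The function k x - c ln x is convex, and k < c/x says that it still decreases at [x], so going
    from the mean up to [x] lowers it strictly. This is the source of strictness in
    [incr_val_midpoint]. *)
Lemma log_linear_midpoint (k x t1 t2 d : R) : 0 < t1 -> 0 < t2 -> 0 < d ->
  x = (t1 + t2) / 2 + d -> k < c / x ->
  k * x - c * ln x < k * ((t1 + t2) / 2) - c * ((ln t1 + ln t2) / 2).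
Proof.
move=> t10 t20 d0 xE kx.
have ta0 : 0 < (t1 + t2) / 2 by rewrite divr_gt0// addr_gt0.
have x0 : 0 < x by rewrite xE addr_gt0.
have l1 : c * ((ln t1 + ln t2) / 2) <= c * ln ((t1 + t2) / 2).
  by rewrite ler_pM2l// ln_midpoint_ge.
have l2 : c * (ln ((t1 + t2) / 2) - ln x) <= c * ((t1 + t2) / 2 / x - 1).
  by rewrite ler_pM2l// ln_sub_le.
have l3 : c * ((t1 + t2) / 2 / x - 1) = - (c / x * d).
  have -> : (t1 + t2) / 2 = x - d by rewrite xE addrK.
  by field; rewrite lt0r_neq0.
have l4 : k * d < c / x * d by rewrite ltr_pM2r.
have l5 : k * x = k * ((t1 + t2) / 2) + k * d by rewrite xE mulrDr.
move: l1 l2; rewrite l5 l3 mulrBr.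
move: l4; set A := k * d; set B := c / x * d; set C := c * ln x.
set D := c * ln _; set E := c * _; set F := k * _; lra.
Qed.

(* The only concave contribution is [tau * lambda ^+ 2 / (2 * nu) * theta];
   the logarithm compensates for it as long as theta is small against
   [nu * c / (tau * lambda ^+ 2)], which the energy bound guarantees. *)
Lemma incr_val_midpoint tau eta p1 p2 : 0 < tau -> p1 != p2 ->
  tau * lambda ^+ 2 * energy eta <= nu * c ^+ 2 ->
  0 < curve_th tau eta p1 -> 0 < curve_th tau eta p2 ->
  let p3 := (p1 + p2) / 2 in
  0 < curve_th tau eta p3 /\
  incr_val tau eta (curve tau eta p3) <
  (incr_val tau eta (curve tau eta p1) + incr_val tau eta (curve tau eta p2)) / 2.
Proof.
move=> t0 p12 tE th1 th2 p3.
have tn := lt0r_neq0 t0.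
have a0 := curve_a_gt0 tau; set a := curve_a tau in a0; set b := curve_b tau eta.
pose th := curve_th tau eta; rewrite -!/(th _) in th1 th2 *.
set ta := (th p1 + th p2) / 2.
(* Excess of the temperature at the midpoint over the mean: a quadratic with leading coefficient
   -a/(mc). *)
set dl := a * (p1 - p2) ^+ 2 / (4 * m * c).
have dl0 : 0 < dl.
  rewrite /dl divr_gt0//; last by rewrite mulr_gt0// mulr_gt0.
  by rewrite mulr_gt0// exprn_even_gt0//= subr_eq0.
have th3E : th p3 = ta + dl.
  by rewrite /ta /dl /th /curve_th /p3 -/a -/b; field; rewrite mn cn.
have ta0 : 0 < ta by rewrite divr_gt0// addr_gt0.
have th3 : 0 < th p3 by rewrite th3E addr_gt0.
have tale : ta <= th p3 by rewrite th3E lerDl ltW.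
split=> //.
pose U p := a * p - b.
(* Expanding the dissipation square leaves a part affine in p, a part of the form k theta - c ln
   theta, and two quotients u^2/theta. *)
have valE p : 0 < th p -> incr_val tau eta (curve tau eta p) =
   lambda * tau / m * p + c * ln (thof eta) + lambda / nu * U p
   + (tau * lambda ^+ 2 / (2 * nu) * th p - c * ln (th p))
   + (2 * nu * tau)^-1 * (U p ^+ 2 / th p) + tau * nu / (2 * m ^+ 2) * (p ^+ 2 / th p).
  move=> thp; rewrite /incr_val !vec3E -/th /U /a /b /curve_a /curve_b.
  set l1 := ln _; set l2 := ln _; move: (th p) thp => x /lt0r_neq0 xn.
  by field; rewrite mn tn nn xn.
rewrite !valE//.
have U3 : U p3 = (U p1 + U p2) / 2 by rewrite /U /p3; field.
have q1 := sqr_over_midpoint_le (U p1) (U p2) th1 th2 tale.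
have q2 := sqr_over_midpoint_le p1 p2 th1 th2 tale.
rewrite -U3 in q1; rewrite -/p3 in q2.
have {}q1 : (2 * nu * tau)^-1 * (U p3 ^+ 2 / th p3) <=
    (2 * nu * tau)^-1 * ((U p1 ^+ 2 / th p1 + U p2 ^+ 2 / th p2) / 2).
  by rewrite ler_wpM2l// invr_ge0 ltW// mulr_gt0// mulr_gt0.
have {}q2 : tau * nu / (2 * m ^+ 2) * (p3 ^+ 2 / th p3) <=
    tau * nu / (2 * m ^+ 2) * ((p1 ^+ 2 / th p1 + p2 ^+ 2 / th p2) / 2).
  by rewrite ler_wpM2l// ltW// divr_gt0// mulr_gt0// exprn_gt0.
have q3 : tau * lambda ^+ 2 / (2 * nu) * th p3 - c * ln (th p3) <
    tau * lambda ^+ 2 / (2 * nu) * ta - c * ((ln (th p1) + ln (th p2)) / 2).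
  apply: (@log_linear_midpoint _ _ _ _ dl) => //.
  (* The decay of energy bounds the midpoint temperature; with the condition on [tau] this yields k
     < c/theta with a factor 2 to spare. *)
  have e3 : c * th p3 <= energy eta.
    have := energy_le (curve_adm th3); apply: le_trans.
    by have := thof_energy (curve tau eta p3); rewrite vec3E.
  have tl0 : 0 < tau * lambda ^+ 2 by rewrite mulr_gt0// exprn_gt0.
  rewrite ltr_pdivlMr// mulrAC ltr_pdivrMr ?mulr_gt0// -(ltr_pM2r c_gt0).
  have h1 : tau * lambda ^+ 2 * (c * th p3) <= nu * c ^+ 2.
    by apply: le_trans tE; rewrite ler_pM2l.
  have h2 : 0 < nu * c ^+ 2 by rewrite mulr_gt0// exprn_gt0.
  have -> : tau * lambda ^+ 2 * th p3 * c = tau * lambda ^+ 2 * (c * th p3) by ring.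
  have -> : c * (2 * nu) * c = 2 * (nu * c ^+ 2) by ring.
  by move: h1 h2; set X := tau * _ * _; set Y := nu * _; lra.
have lin : lambda * tau / m * p3 + lambda / nu * U p3 =
    (lambda * tau / m * p1 + lambda / nu * U p1 + lambda * tau / m * p2 + lambda / nu * U p2) / 2.
  by rewrite U3 /p3; ring.
move: lin q1 q2 q3; rewrite /ta; clear.
set A3 := lambda / nu * U p3; set B3 := lambda * tau / m * p3; set C3 := _ * (p3 ^+ 2 / _).
set D3 := _ * (U p3 ^+ 2 / _); set E3 := _ * th p3; set F3 := c * ln (th p3).
set K1 := (2 * nu * tau)^-1; set K2 := tau * nu / _; set K3 := tau * lambda ^+ 2 / _.
set X1 := U p1 ^+ 2 / _; set X2 := U p2 ^+ 2 / _; set Y1 := p1 ^+ 2 / _; set Y2 := p2 ^+ 2 / _.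
set L0 := ln (thof eta); set L1 := ln (th p1); set L2 := ln (th p2).
move: (lambda / nu) (lambda * tau / m) (th p1) (th p2) (U p1) (U p2) => k4 k5 h1 h2 u1 u2.
clearbody A3 B3 C3 D3 E3 F3 K1 K2 K3 X1 X2 Y1 Y2 L0 L1 L2; lra.
Qed.

Lemma argmin_unique tau eta y z : 0 < tau -> 0 < thof eta ->
  tau * lambda ^+ 2 * energy eta <= nu * c ^+ 2 ->
  argmin (incr tau eta) y -> argmin (incr tau eta) z -> y = z.
Proof.
move=> t0 e0 tE ymin zmin.
have ay := argmin_adm t0 e0 ymin; have az := argmin_adm t0 e0 zmin.
have [_ ymin'] := (minP y t0 e0 (ex_intro _ y ay)).1 ymin.
have [_ zmin'] := (minP z t0 e0 (ex_intro _ z az)).1 zmin.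
have ye := adm_curve ay; have ze := adm_curve az.
have [e|yz] := eqVneq (pof y) (pof z); first by rewrite ye e -ze.
have [y0 _ _] := ay; have [z0 _ _] := az.
have thy : 0 < curve_th tau eta (pof y) by move: y0; rewrite {1}ye vec3E.
have thz : 0 < curve_th tau eta (pof z) by move: z0; rewrite {1}ze vec3E.
have [th3 lt3] := incr_val_midpoint t0 yz tE thy thz.
rewrite -ye -ze in lt3.
exfalso; have := ymin' _ (curve_adm th3); have := zmin' _ (curve_adm th3).
by move: lt3; move: (incr_val _ _ _) (incr_val _ _ y) (incr_val _ _ z) => A B C; lra.
Qed.

End Step.

(** * Sup norm and Euclidean norm on R^3, elementary bounds *)

Section SupNorm.
Variable R : realType.
Implicit Types (u v : 'cV[R]_3) (M : R).

Lemma cV3_norm_le u M :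
  `|qof u| <= M -> `|pof u| <= M -> `|thof u| <= M -> `|u| <= M.
Proof.
move=> hq hp ht; rewrite [`|u|]mx_normrE; apply: bigmax_le.
  by apply: le_trans hq.
by case=> i j _ /=; rewrite ord1; move: i; apply: ord3P.
Qed.

Lemma entry_le_norm u i : `|u i 0| <= `|u|.
Proof. by rewrite [`|u|]mx_normrE (le_bigmax _ (fun ij => `|u ij.1 ij.2|) (i, 0)). Qed.

Lemma qof_le_norm u : `|qof u| <= `|u|. Proof. exact: entry_le_norm. Qed.
Lemma pof_le_norm u : `|pof u| <= `|u|. Proof. exact: entry_le_norm. Qed.
Lemma thof_le_norm u : `|thof u| <= `|u|. Proof. exact: entry_le_norm. Qed.

(** The constant 2 stands for the square root of 3. *)
Lemma enorm_le_norm u : enorm u <= 2 * `|u|.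
Proof.
have u0 : 0 <= 2 * `|u| by rewrite mulr_ge0.
rewrite -[leRHS]ger0_norm// -sqrtr_sqr /enorm ler_wsqrtr// dotE.
have sq x : `|x| <= `|u| -> x * x <= `|u| ^+ 2.
  by move=> xu; rewrite -expr2 -[x ^+ 2]ger0_norm ?sqr_ge0// normrX lerXn2r// nnegrE.
have h : 0 <= `|u| ^+ 2 by exact: sqr_ge0.
have := sq _ (qof_le_norm u); have := sq _ (pof_le_norm u).
have := sq _ (thof_le_norm u); rewrite exprMn; lra.
Qed.

End SupNorm.

Lemma ler_norm_pM (R : realType) (a x B : R) : 0 < a -> `|x| <= B -> `|a * x| <= a * B.
Proof. by move=> a0 xB; rewrite normrM gtr0_norm// ler_pM2l. Qed.

Lemma sqr_le_norm (R : realType) (x B : R) : `|x| <= B -> x ^+ 2 <= B ^+ 2.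
Proof.
move=> xB; have B0 : 0 <= B by exact: le_trans xB.
by rewrite -[x ^+ 2]ger0_norm ?sqr_ge0// normrX lerXn2r.
Qed.

Lemma ler_norm_pMV (R : realType) (a d x B : R) : 0 < a -> 0 < d -> `|x| <= B ->
  `|a * x / d| <= a * B / d.
Proof.
move=> a0 d0 xB; rewrite (mulrAC a x) (mulrAC a B).
by apply: ler_norm_pM => //; rewrite divr_gt0.
Qed.

(** * A priori estimates *)

Section Scheme.
Variables (R : realType) (m nu kappa lambda c : R).
Hypotheses (m_gt0 : 0 < m) (nu_gt0 : 0 < nu) (kappa_gt0 : 0 < kappa)
    (lambda_gt0 : 0 < lambda) (c_gt0 : 0 < c).
Implicit Types (y z eta : 'cV[R]_3) (tau p : R).
Let mn := lt0r_neq0 m_gt0.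
Let nn := lt0r_neq0 nu_gt0.
Let cn := lt0r_neq0 c_gt0.
Local Notation admissible := (admissible m kappa c).
Local Notation residual := (residual m nu kappa lambda).
Local Notation incr := (incr m nu kappa lambda c).
Local Notation energy := (energy m kappa c).
Local Notation scheme_sol := (scheme_sol m nu kappa lambda c).

Definition vfield y : 'cV[R]_3 :=
  vec3 (pof y / m) (- (nu * pof y / m) - kappa * qof y - lambda * thof y)
       (nu * pof y ^+ 2 / (m ^+ 2 * c) + lambda * pof y * thof y / (m * c)).

(** The consistency error is r (0, 1, -p/(mc)), along the range of [Kop y]: the equation for q is
    exact, and the single number r controls the other two. *)
Lemma slope_residual tau eta y : 0 < tau -> admissible tau eta y ->
  tau^-1 *: (y - eta) - vfield y =
  vec3 0 (residual tau eta y) (- (pof y / (m * c)) * residual tau eta y).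
Proof.
move=> /lt0r_neq0 tn [_ hq hth].
apply: vec3P; rewrite !compE !vec3E /residual.
- by rewrite hq; field; rewrite tn mn.
- by field; rewrite tn mn.
- by rewrite hth; field; rewrite tn mn cn.
Qed.

Lemma residual_sqrt (B d : R) : 0 < B -> 0 < d -> exists2 K : R, 0 <= K &
  forall tau eta y, 0 < tau -> d <= thof eta -> `|eta| <= B -> `|y| <= B ->
    argmin (incr tau eta) y -> residual tau eta y ^+ 2 <= K * tau.
Proof.
move=> B0 d0.
pose b1 := B / (m * c); pose b2 := lambda * B + nu * B / m; pose b0 := b1 * b2.
pose A := 4 * nu * c / d.
have b10 : 0 < b1 by rewrite divr_gt0// mulr_gt0.
have b20 : 0 < b2 by rewrite addr_gt0// ?divr_gt0// mulr_gt0.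
have A0 : 0 < A by rewrite divr_gt0// mulr_gt0// mulr_gt0.
pose itau := 2 * A * b1 ^+ 2.
have itau0 : 0 < itau.
  by apply: mulr_gt0; [apply: mulr_gt0|apply: exprn_gt0].
pose R0 := 2 * B * itau + kappa * B + b2.
have R00 : 0 < R0.
  by apply: addr_gt0 => //; apply: addr_gt0; apply: mulr_gt0 => //; apply: mulr_gt0.
exists (2 * A * b0 ^+ 2 + R0 ^+ 2 * itau).
  by apply: addr_ge0; apply: mulr_ge0; rewrite ?sqr_ge0 ?ltW// mulr_gt0.
move=> tau eta y t0 de eB yB ymin.
have e0 := lt_le_trans d0 de.
have ay := argmin_adm m_gt0 nu_gt0 kappa_gt0 c_gt0 t0 e0 ymin.
have := residual_bound m_gt0 nu_gt0 kappa_gt0 c_gt0 t0 e0 ymin.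

have := slope_residual t0 ay.
move/(congr1 (@thof R)); rewrite !compE !vec3E.
set r := residual _ _ _.
have pB := le_trans (pof_le_norm y) yB; have qB := le_trans (qof_le_norm y) yB.
have tB := le_trans (thof_le_norm y) yB.
have peB := le_trans (pof_le_norm eta) eB.
move=> hth hr.
have [small|large] := leP (itau * tau) 1; last first.
  have rR0 : `|r| <= R0.
    have h1 : `|pof y - pof eta| / tau <= 2 * B * itau.
      rewrite ler_pdivrMr// -(mulrA (2 * B)).
      have : `|pof y - pof eta| <= 2 * B.
        by apply: le_trans (ler_normB _ _) _; lra.
      move=> /le_trans; apply; rewrite -[leLHS]mulr1 ler_pM2l ?mulr_gt0//.
      exact: ltW.
    rewrite /r /residual; apply: le_trans (ler_normD _ _) _.
    rewrite /R0 /b2 addrA; apply: lerD; last first.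
      exact: ler_norm_pMV.
    apply: le_trans (ler_normD _ _) _; apply: lerD; last first.
      exact: ler_norm_pM.
    apply: le_trans (ler_normD _ _) _; apply: lerD; last first.
      exact: ler_norm_pM.
    by rewrite normrM [`|tau^-1|]gtr0_norm ?invr_gt0.
  have : r ^+ 2 <= R0 ^+ 2.
    exact: sqr_le_norm.
  move=> /le_trans; apply; rewrite mulrDl -[leLHS]add0r; apply: lerD.
    apply: mulr_ge0; last exact: ltW.
    by apply: mulr_ge0; [rewrite ltW// mulr_gt0|exact: sqr_ge0].
  by rewrite -(mulrA (R0 ^+ 2)) -[leLHS]mulr1 ler_wpM2l ?sqr_ge0// ltW.
have dth : `|thof y - thof eta| <= tau * (b1 * `|r| + b0).
  have -> : thof y - thof eta = tau * (- (pof y / (m * c)) * (r - nu * pof y / m - lambda * thof y)).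
    have e : tau^-1 * (thof y - thof eta) = - (pof y / (m * c)) * r
        + (nu * pof y ^+ 2 / (m ^+ 2 * c) + lambda * pof y * thof y / (m * c)).
      by rewrite -hth subrK.
    rewrite -[LHS](@mulVKf _ tau) ?lt0r_neq0// e; congr (_ * _).
    by field; rewrite mn cn.
  rewrite normrM (gtr0_norm t0) ler_pM2l//.
  rewrite /b0 -mulrDr normrM; apply: ler_pM => //.
    rewrite normrN mulrC; rewrite /b1 [B / _]mulrC; apply: ler_norm_pM => //.
    by rewrite invr_gt0 mulr_gt0.
  apply: le_trans (ler_normB _ _) _; rewrite /b2.
  rewrite [lambda * B + _]addrC addrA; apply: lerD.
    apply: le_trans (ler_normB _ _) _; apply: lerD => //.
    exact: ler_norm_pMV.
  exact: ler_norm_pM.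
have {}dth : (thof y - thof eta) ^+ 2 <= tau ^+ 2 * (2 * b1 ^+ 2 * r ^+ 2 + 2 * b0 ^+ 2).
  have b00 : 0 < b0 by rewrite mulr_gt0.
  have : (thof y - thof eta) ^+ 2 <= (tau * (b1 * `|r| + b0)) ^+ 2.
    exact: sqr_le_norm.
  move=> /le_trans; apply; rewrite exprMn ler_pM2l ?exprn_gt0//.
  rewrite -subr_ge0 -(real_normK (num_real r)).
  rewrite (_ : _ - _ = (b1 * `|r| - b0) ^+ 2) ?sqr_ge0//; ring.
have h1 : tau * r ^+ 2 * d <= 2 * nu * c * (tau ^+ 2 * (2 * b1 ^+ 2 * r ^+ 2 + 2 * b0 ^+ 2)).
  apply: (@le_trans _ _ (tau * r ^+ 2 * thof eta)).
    by rewrite ler_wpM2l// mulr_ge0 ?sqr_ge0// ltW.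
  by apply: le_trans hr _; rewrite ler_wpM2l// ltW// !mulr_gt0.
have h2 : r ^+ 2 <= A * tau * (b1 ^+ 2 * r ^+ 2 + b0 ^+ 2).
  rewrite -(ler_pM2l t0) -(ler_pM2r d0); apply: le_trans h1 _.
  rewrite le_eqVlt; apply/orP; left; apply/eqP.
  by rewrite /A; field; rewrite lt0r_neq0.
have h3 : itau * tau * r ^+ 2 <= r ^+ 2 by rewrite -[leRHS]mul1r ler_wpM2r ?sqr_ge0.
have h4 : 0 <= R0 ^+ 2 * itau * tau by rewrite mulr_ge0 ?ltW// mulr_gt0// exprn_gt0.
have h5 : A * tau * (b1 ^+ 2 * r ^+ 2) = itau * tau * r ^+ 2 / 2.
  by rewrite /itau; field.
move: h2; rewrite mulrDr h5 => h2.
have h6 : 2 * A * b0 ^+ 2 * tau = 2 * (A * tau * b0 ^+ 2) by ring.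
rewrite mulrDl h6; move: h2 h3 h4.
set X1 := itau * _ * _; set X2 := A * _ * _; set X3 := R0 ^+ 2 * _ * _; set X4 := r ^+ 2.
by move=> ? ? ?; lra.
Qed.

Let exmin tau eta := @argmin_exists _ _ _ _ _ _ m_gt0 nu_gt0 kappa_gt0 lambda_gt0 c_gt0 tau eta.
Let adm tau eta y := @argmin_adm _ _ _ _ lambda _ m_gt0 nu_gt0 kappa_gt0 c_gt0 tau eta y.

Lemma scheme_exists T N t y0 : 0 < thof y0 -> is_partition T N t ->
  exists y : nat -> 'cV[R]_3, scheme_sol N t y0 y.
Proof.
move=> th0 [_ _ tlt].
(* The default [eta] is returned only if there is no minimizer; positivity of the temperature,
   propagated by induction, excludes this for i < N. *)
pose step i eta := xget eta (argmin (incr (t i.+1 - t i) eta)).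
pose y := nat_rect (fun=> 'cV[R]_3) y0 step.
have stepP i : (i < N)%N -> 0 < thof (y i) -> argmin (incr (t i.+1 - t i) (y i)) (y i.+1).
  move=> iN yi0; apply: xgetPex; apply: exmin => //.
  by rewrite subr_gt0 tlt.
have ypos i : (i <= N)%N -> 0 < thof (y i).
  elim: i => [//|i ih] iN; have yi0 := ih (ltnW iN).
  have t0 : 0 < t i.+1 - t i by rewrite subr_gt0 tlt.
  by have [] := adm t0 yi0 (stepP i iN yi0).
by exists y; split=> // i iN; apply: stepP => //; apply: ypos; exact: ltnW.
Qed.

Lemma scheme_invariants T N t y0 (y : nat -> 'cV[R]_3) i : 0 < thof y0 -> is_partition T N t ->
  scheme_sol N t y0 y -> (i <= N)%N ->
  [/\ 0 < thof (y i), energy (y i) <= energy y0 &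
      - lambda * qof y0 + c * ln (thof y0) <= - lambda * qof (y i) + c * ln (thof (y i))].
Proof.
move=> th0 [_ _ tlt] [y0E ymin]; elim: i => [|i ih] iN; first by rewrite y0E.
have t0 : 0 < t i.+1 - t i by rewrite subr_gt0 tlt.
have [yi0 ei si] := ih (ltnW iN).
have ay := adm t0 yi0 (ymin i iN); have [yi1 _ _] := ay.
split=> //.
  by apply: le_trans ei; exact: (energy_le m_gt0 kappa_gt0 c_gt0 ay).
apply: le_trans si _.
exact: (entropy_increase m_gt0 nu_gt0 kappa_gt0 c_gt0 t0 yi0 (ymin i iN)).
Qed.

(** Decay of energy bounds all components from above; growth of entropy then bounds ln theta from
    below, because q is already bounded. The constants are chosen before the final time T. *)
Lemma scheme_estimates y0 : 0 < thof y0 -> exists B thmin K : R,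
  [/\ 0 < B, 0 < thmin, 0 <= K &
  forall T N t (y : nat -> 'cV[R]_3), is_partition T N t -> scheme_sol N t y0 y ->
    (forall i, (i <= N)%N -> `|y i| <= B /\ thmin <= thof (y i)) /\
    (forall i, (i < N)%N ->
      `|(t i.+1 - t i)^-1 *: (y i.+1 - y i) - vfield (y i.+1)|
         <= K * Num.sqrt (t i.+1 - t i))].
Proof.
move=> th0; set E0 := energy y0.
have E00 : 0 < E0.
  by apply: lt_le_trans (thof_energy c m_gt0 kappa_gt0 y0); rewrite mulr_gt0.
pose Bp := Num.sqrt (2 * m * E0); pose Bq := Num.sqrt (2 * E0 / kappa).
pose B := Bp + Bq + E0 / c.
have Bp0 : 0 <= Bp by exact: sqrtr_ge0.
have Bq0 : 0 <= Bq by exact: sqrtr_ge0.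
have Ec0 : 0 < E0 / c by rewrite divr_gt0.
have B0 : 0 < B by rewrite /B ltr_wpDl// addr_ge0.
(* Lower bound for c ln theta: the initial entropy (up to the constant c) plus lambda q, with q
   replaced by [- B]. *)
pose s0 := - lambda * qof y0 + c * ln (thof y0) - lambda * B.
pose d := expR (s0 / c).
have d0 : 0 < d by exact: expR_gt0.
have bnd T N t (y : nat -> 'cV[R]_3) i : is_partition T N t -> scheme_sol N t y0 y -> (i <= N)%N ->
    `|y i| <= B /\ d <= thof (y i).
  move=> pt sy iN; have [yi0 ei si] := scheme_invariants th0 pt sy iN.
  have hp : `|pof (y i)| <= Bp.
    rewrite -sqrtr_sqr ler_wsqrtr//.
    apply: le_trans (pof_energy m_gt0 kappa_gt0 c_gt0 yi0) _.
    by rewrite ler_pM2l// mulr_gt0.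
  have hq : `|qof (y i)| <= Bq.
    rewrite -sqrtr_sqr ler_wsqrtr// ler_pdivlMr// mulrC.
    apply: le_trans (qof_energy kappa m_gt0 c_gt0 yi0) _.
    by rewrite ler_pM2l.
  have ht : `|thof (y i)| <= E0 / c.
    rewrite gtr0_norm// ler_pdivlMr// mulrC.
    exact: le_trans (thof_energy c m_gt0 kappa_gt0 (y i)) _.
  have yB : `|y i| <= B by apply: cV3_norm_le; rewrite /B; lra.
  split=> //.
  rewrite -ler_ln ?posrE// expRK ler_pdivrMr// mulrC /s0.
  have : - lambda * qof (y i) <= lambda * B.
    rewrite mulNr -mulrN ler_pM2l// lerNl.
    by have := le_trans (qof_le_norm (y i)) yB; rewrite ler_norml => /andP[].
  by move: si; lra.
have [K0 K00 resK] := residual_sqrt B0 d0.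
pose b := 1 + B / (m * c).
have b1 : 0 <= B / (m * c) by rewrite divr_ge0 ?mulr_ge0 ?ltW.
exists B, d, (Num.sqrt K0 * b); split=> //.
  apply: mulr_ge0; first exact: sqrtr_ge0. by apply: addr_ge0.
move=> T N t y pt sy; split=> [i iN|i iN]; first exact: (bnd _ _ _ _ _ pt sy iN).
have [_ _ tlt] := pt; have [_ ymin] := sy.
have t0 : 0 < t i.+1 - t i by rewrite subr_gt0 tlt.
have [yiB yid] := bnd _ _ _ _ _ pt sy (ltnW iN).
have [yi1B _] := bnd _ _ _ _ _ pt sy iN.
have yi0 := lt_le_trans d0 yid.
have ay := adm t0 yi0 (ymin i iN).
rewrite slope_residual//.
have := resK _ _ _ t0 yid yiB yi1B (ymin i iN).
set r := residual _ _ _ => rK.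
have {rK}rs : `|r| <= Num.sqrt K0 * Num.sqrt (t i.+1 - t i).
  by rewrite -sqrtrM// -sqrtr_sqr ler_wsqrtr.
have s0' : 0 <= Num.sqrt K0 * Num.sqrt (t i.+1 - t i) by rewrite mulr_ge0 ?sqrtr_ge0.
have -> : Num.sqrt K0 * b * Num.sqrt (t i.+1 - t i) = Num.sqrt K0 * Num.sqrt (t i.+1 - t i)
    + Num.sqrt K0 * Num.sqrt (t i.+1 - t i) * (B / (m * c)) by rewrite /b; ring.
have h : 0 <= Num.sqrt K0 * Num.sqrt (t i.+1 - t i) * (B / (m * c)) by rewrite mulr_ge0.
apply: cV3_norm_le; rewrite vec3E.
- by rewrite normr0 addr_ge0.
- by apply: le_trans rs _; rewrite lerDl.
- apply: le_trans (_ : Num.sqrt K0 * Num.sqrt (t i.+1 - t i) * (B / (m * c)) <= _); last first.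
    by rewrite lerDr.
  rewrite normrM [leLHS]mulrC; apply: ler_pM => //.
  rewrite normrN normrM [`|(m * c)^-1|]gtr0_norm ?invr_gt0 ?mulr_gt0//.
  rewrite ler_pM2r ?invr_gt0 ?mulr_gt0//.
  exact: le_trans (pof_le_norm _) yi1B.
Qed.

End Scheme.

(** * Passing to the limit in inequalities between real numbers *)

Section Archimedean.
Variable R : realType.

Lemma exists_inv_lt (x e : R) : 0 < e -> exists n : nat, x / n.+1%:R <= e.
Proof.
move=> e0; exists (Num.bound `|x / e|).
rewrite ler_pdivrMr// mulrC -ler_pdivrMr//.
apply: le_trans (ler_norm _) _; apply/ltW.
apply: lt_le_trans (archi_boundP (normr_ge0 _)) _.
by rewrite ler_nat.
Qed.

Lemma le_add_small (x y C : R) (e : nat -> R) : 0 <= C ->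
  (forall d, 0 < d -> exists n, e n <= d) ->
  (forall n, x <= y + C * e n) -> x <= y.
Proof.
move=> C0 e0 xy; apply/ler_addgt0Pr => d d0.
have [|n en] := e0 (d / (C + 1)); first by rewrite divr_gt0// ltr_wpDl.
apply: le_trans (xy n) _; rewrite lerD2l.
apply: (@le_trans _ _ ((C + 1) * (d / (C + 1)))); last first.
  by rewrite mulrC divfK// lt0r_neq0// ltr_wpDl.
apply: (@le_trans _ _ (C * (d / (C + 1)))); first exact: ler_wpM2l.
by rewrite ler_wpM2r ?lerDl// divr_ge0 ?ltW// ltr_wpDl.
Qed.

(** The intervals [u n - e n, u n + e n] meet pairwise, hence have a common point: the supremum of
    their left ends. *)
Lemma mutually_close_limit (u e : nat -> R) :
  (forall n k, `|u n - u k| <= e n + e k) -> exists l, forall n, `|u n - l| <= e n.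
Proof.
move=> ue; pose S := [set u n - e n | n in [set: nat]].
have Sub k : ubound S (u k + e k).
  by move=> _ [n _ <-]; have := ue n k; rewrite ler_norml => /andP[_]; lra.
have S0 : has_sup S by split; [exists (u 0%N - e 0%N), 0%N|exists (u 0%N + e 0%N)].
exists (sup S) => n.
have h1 : u n - e n <= sup S by apply: sup_upper_bound => //; exists n.
have h2 : sup S <= u n + e n by apply: ge_sup; [case: S0|exact: Sub].
by rewrite ler_norml; apply/andP; split; lra.
Qed.

End Archimedean.

(** * Approximate solutions of differential equations *)

Section ApproximateSolutions.
Variables (R : realType) (V : normedModType R) (F : V -> V).
Implicit Types (z : R -> V) (T B A L e : R).

Definition lipschitz_ball B L :=
  forall x y, `|x| <= B -> `|y| <= B -> `|F x - F y| <= L * `|x - y|.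

(* One explicit Euler step of length [h] from any time makes an error
   [O (h ^+ 2 + h * e)]; [e = 0] characterizes exact solutions. *)
Definition approx_sol T B A e z :=
  (forall s, 0 <= s <= T -> `|z s| <= B) /\
  (forall s r, 0 <= s -> s <= r -> r <= T ->
     `|z r - z s - (r - s) *: F (z s)| <= A * (r - s) * (r - s + e)).

Lemma approx_sol_le T B B' A A' e z : B <= B' -> 0 <= A' -> A <= A' -> 0 <= e ->
  approx_sol T B A e z -> approx_sol T B' A' e z.
Proof.
move=> BB A0 AA e0 [zB zA]; split=> [s /zB/le_trans|s r s0 sr rT]; first exact.
apply: le_trans (zA s r s0 sr rT) _.
by rewrite -!mulrA ler_wpM2r// mulr_ge0 ?subr_ge0// addr_ge0// subr_ge0.
Qed.

(** Discrete Gronwall estimate on an auxiliary grid of n + 1 equal steps on [0, s], unrelated to any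
    partition of the scheme. Its own contribution, of order h, vanishes as n grows, so that only e1
    + e2 remains. *)
Lemma approx_sol_dist T B A L e1 e2 z1 z2 : 0 <= L -> 0 <= A ->
  lipschitz_ball B L -> 0 <= e1 -> 0 <= e2 ->
  approx_sol T B A e1 z1 -> approx_sol T B A e2 z2 -> z1 0 = z2 0 ->
  forall s, 0 <= s <= T -> `|z1 s - z2 s| <= T * A * expR (L * T) * (e1 + e2).
Proof.
move=> L0 A0 FL e10 e20 [b1 a1] [b2 a2] z0 s /andP[s0 sT].
have T0 := le_trans s0 sT.
set C := T * A * expR (L * T).
have C0 : 0 <= C by rewrite !mulr_ge0 ?expR_ge0.
apply: (@le_add_small _ _ _ (C * 2) (fun n => s / n.+1%:R)).
- by rewrite mulr_ge0.
- by move=> d d0; exact: exists_inv_lt.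
move=> n; set h := s / n.+1%:R.
have h0 : 0 <= h by rewrite divr_ge0.
have nh : n.+1%:R * h = s by rewrite /h mulrC divfK.
(* The two one-step errors, h A (h + e1) and h A (h + e2), added up. *)
set E := h * A * (2 * h + (e1 + e2)).
have E0 : 0 <= E by rewrite !mulr_ge0// addr_ge0 ?mulr_ge0// addr_ge0.
have step k : (k < n.+1)%N ->
    `|z1 (k.+1%:R * h) - z2 (k.+1%:R * h)| <=
    (1 + L * h) * `|z1 (k%:R * h) - z2 (k%:R * h)| + E.
  move=> kn; set a := k%:R * h.
  have a0 : 0 <= a by rewrite mulr_ge0.
  have -> : k.+1%:R * h = a + h by rewrite -addn1 natrD mulrDl mul1r.
  have ahT : a + h <= T.
    apply: le_trans sT; rewrite -nh /a -[X in _ + X]mul1r -mulrDl ler_wpM2r//.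
    by rewrite natr1 ler_nat.
  have aT : a <= T by apply: le_trans ahT; rewrite lerDl.
  have ah : a + h - a = h by rewrite addrAC subrr add0r.
  have aah : a <= a + h by rewrite lerDl.
  have := a1 a (a + h) a0 aah ahT; have := a2 a (a + h) a0 aah ahT.
  rewrite !ah => h2 h1.
  have FD : `|F (z1 a) - F (z2 a)| <= L * `|z1 a - z2 a|.
    by apply: FL; [apply: b1|apply: b2]; rewrite a0.
  have -> : z1 (a + h) - z2 (a + h) = (z1 a - z2 a) + h *: (F (z1 a) - F (z2 a))
     + ((z1 (a + h) - z1 a - h *: F (z1 a)) - (z2 (a + h) - z2 a - h *: F (z2 a))).
    have sp x y w : x = y + w + (x - y - w) :> V by rewrite -(addrA x) -opprD [RHS]addrC subrK.
    rewrite {1}(sp (z1 (a + h)) (z1 a) (h *: F (z1 a))).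
    rewrite {1}(sp (z2 (a + h)) (z2 a) (h *: F (z2 a))).
    have id3 u1 v1 w1 u2 v2 w2 :
        u1 + v1 + w1 - (u2 + v2 + w2) = (u1 - u2) + (v1 - v2) + (w1 - w2) :> V.
      by rewrite !opprD addrACA; congr (_ + _); rewrite addrACA.
    by rewrite id3 scalerBr.
  apply: le_trans (ler_normD _ _) _; rewrite /E.
  have := ler_normD (z1 a - z2 a) (h *: (F (z1 a) - F (z2 a))).
  have := ler_normB (z1 (a + h) - z1 a - h *: F (z1 a)) (z2 (a + h) - z2 a - h *: F (z2 a)).
  rewrite normrZ (ger0_norm h0).
  have : h * `|F (z1 a) - F (z2 a)| <= h * (L * `|z1 a - z2 a|) by rewrite ler_wpM2l.
  move: h1 h2; lra.
(* Cruder than the geometric sum but easy to propagate; the factor [k] times the step [h] inside [E]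
   gives back the elapsed time. *)
have bound k : (k <= n.+1)%N -> `|z1 (k%:R * h) - z2 (k%:R * h)| <=
    k%:R * E * (1 + L * h) ^+ k.
  elim: k => [_|k ih kn]; first by rewrite !mul0r z0 subrr normr0.
  apply: le_trans (step k kn) _.
  have Lh1 : 1 <= 1 + L * h by rewrite lerDl mulr_ge0.
  apply: (@le_trans _ _ ((1 + L * h) * (k%:R * E * (1 + L * h) ^+ k) + E * (1 + L * h) ^+ k.+1)).
    apply: lerD; last by rewrite -[leLHS]mulr1 ler_wpM2l// exprn_ege1.
    by rewrite ler_wpM2l ?ih ?(ltnW kn)// (le_trans _ Lh1).
  by rewrite exprS -natr1 le_eqVlt; apply/orP; left; apply/eqP; ring.
have := bound n.+1 (leqnn _); rewrite nh => /le_trans; apply.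
have powE : (1 + L * h) ^+ n.+1 <= expR (L * T).
  apply: (@le_trans _ _ (expR (L * h) ^+ n.+1)).
    by rewrite lerXn2r ?nnegrE ?expR_ge0 ?expR_ge1Dx// addr_ge0// mulr_ge0.
  by rewrite -expRM_natl ler_expR mulrCA nh ler_wpM2l.
apply: (@le_trans _ _ (n.+1%:R * E * expR (L * T))).
  by rewrite ler_wpM2l// mulr_ge0.
have -> : n.+1%:R * E = s * A * (2 * h + (e1 + e2)) by rewrite /E -nh; ring.
have -> : C * (e1 + e2) + C * 2 * h = T * A * (2 * h + (e1 + e2)) * expR (L * T).
  by rewrite /C; ring.
rewrite ler_wpM2r ?expR_ge0// ler_wpM2r ?addr_ge0 ?mulr_ge0 ?addr_ge0//.
by rewrite ler_wpM2r.
Qed.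

End ApproximateSolutions.

(** * Partitions and piecewise linear interpolation *)

Section Partitions.
Variables (R : realType) (T : R) (N : nat) (t : nat -> R).
Hypothesis pt : is_partition T N t.

Lemma partition0 : t 0%N = 0. Proof. by case: pt. Qed.
Lemma partitionN : t N = T. Proof. by case: pt. Qed.
Lemma partition_lt i : (i < N)%N -> t i < t i.+1. Proof. by case: pt => _ _; exact. Qed.

Lemma partition_le i j : (i <= j)%N -> (j <= N)%N -> t i <= t j.
Proof.
elim: j => [|j ih]; first by rewrite leqn0 => /eqP ->.
rewrite leq_eqVlt => /predU1P[-> //|ij] jN.
exact: le_trans (ih ij (ltnW jN)) (ltW (partition_lt jN)).
Qed.

Lemma partition_ge0 i : (i <= N)%N -> 0 <= t i.
Proof. by rewrite -partition0; exact: partition_le. Qed.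

Lemma partition_leT i : (i <= N)%N -> t i <= T.
Proof. by move=> iN; rewrite -partitionN partition_le. Qed.

Lemma mesh_ge i : (i < N)%N -> t i.+1 - t i <= mesh N t.
Proof.
by move=> iN; apply: (le_bigmax 0 (fun i : 'I_N => t i.+1 - t i) (Ordinal iN)).
Qed.

Lemma mesh_ge0 : 0 <= mesh N t. Proof. exact: bigmax_ge_id. Qed.

Lemma mesh_leT : 0 <= T -> mesh N t <= T.
Proof.
move=> T0; apply: bigmax_le => // i _.
by rewrite lerBlDr (le_trans (partition_leT (ltn_ord i)))// lerDl partition_ge0// ltnW.
Qed.

Lemma cellE i s : (i < N)%N -> t i < s -> s <= t i.+1 -> cell N t s = i.+1.
Proof.
move=> iN ts st; rewrite /cell; set p := fun i => _.
have sz : size (iota 0 N.+1) = N.+1 by rewrite size_iota.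
have [lt|gt|//] := ltngtP (find p (iota 0 N.+1)) i.+1.
  have : p (nth 0%N (iota 0 N.+1) (find p (iota 0 N.+1))).
    by apply: nth_find; rewrite has_find sz (ltn_trans lt).
  rewrite nth_iota ?add0n ?(ltn_trans lt)// /p => h.
  have := partition_le (lt : (_ <= i)%N) (ltnW iN).
  by rewrite leNgt (lt_le_trans ts h).
have := before_find 0%N gt; rewrite nth_iota ?add0n// /p => /negbT.
by rewrite st.
Qed.

Lemma cell_le0 s : s <= 0 -> cell N t s = 0%N.
Proof. by move=> s0; rewrite /cell /= partition0 s0. Qed.

Lemma in_cell s : 0 < s -> s <= T -> exists i, [/\ (i < N)%N, t i < s & s <= t i.+1].
Proof.
rewrite -partitionN => s0 sN.
(* The least index is sought among all naturals; since N qualifies, it is at most N. *)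
have ex : exists k, s <= t k by exists N.
have := ex_minnP ex; case=> k sk kmin.
case: k sk kmin => [|k] sk kmin; first by move: sk; rewrite partition0 leNgt s0.
exists k; split=> //; first exact: (kmin N).
by rewrite ltNge; apply/negP => /kmin; rewrite ltnn.
Qed.

Variable y : nat -> 'cV[R]_3.

Definition slope i : 'cV[R]_3 := (t i.+1 - t i)^-1 *: (y i.+1 - y i).

Lemma pwlinear0 : pwlinear N t y 0 = y 0%N.
Proof. by rewrite /pwlinear cell_le0. Qed.

Lemma pwlinear_nodeS i : (i < N)%N -> pwlinear N t y (t i.+1) = y i.+1.
Proof.
move=> iN; rewrite /pwlinear (@cellE i)// ?partition_lt//.
by rewrite subrr mul0r scale0r addr0 divff ?scale1r// subr_eq0 gt_eqF ?partition_lt.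
Qed.

Lemma pwlinear_node i : (i <= N)%N -> pwlinear N t y (t i) = y i.
Proof. by case: i => [_|i]; [rewrite partition0 pwlinear0|exact: pwlinear_nodeS]. Qed.

(** The formula holds on the closed cell, although [cell] attributes the left node to the preceding
    one: this is the continuity of the interpolation at the nodes. *)
Lemma pwlinearE i s : (i < N)%N -> t i <= s -> s <= t i.+1 ->
  pwlinear N t y s = y i + (s - t i) *: slope i.
Proof.
move=> iN; rewrite le_eqVlt => /predU1P[<- _|ts st].
  by rewrite subrr scale0r addr0 pwlinear_node// ltnW.
rewrite /pwlinear (cellE iN ts st) /slope scalerA scalerBr [RHS]addrCA; congr (_ + _).
have d0 : t i.+1 - t i != 0 by rewrite subr_eq0 gt_eqF ?partition_lt.
rewrite -[X in _ = X - _]scale1r -scalerBl; congr (_ *: _).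
by field.
Qed.

(** A mean value inequality involving only the slopes of the cells that meet [s, r]. With w = 0 it
    gives Lipschitz bounds, with w the field at time s the one-step error of [approx_sol]. *)
Lemma pwlinear_mean_value w M s r : 0 <= M -> 0 <= s -> s <= r -> r <= T ->
  (forall i, (i < N)%N -> t i <= r -> s <= t i.+1 -> `|slope i - w| <= M) ->
  `|pwlinear N t y r - pwlinear N t y s - (r - s) *: w| <= M * (r - s).
Proof.
move=> M0 s0 sr; rewrite -partitionN.
have : (N <= N)%N by [].
(* Induction on the index of a node to the right of [r], the partition being fixed; [s, r] is cut at
   the last node before it. *)
move: s r s0 sr; elim: {1 3}N => [s r s0 sr _|k ih s r s0 sr kN rk hM].
  rewrite partition0 => r0 _.
  have -> : r = 0 by apply/eqP; rewrite eq_le r0 (le_trans s0).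
  have -> : s = 0 by apply/eqP; rewrite eq_le s0 (le_trans sr).
  by rewrite !subrr scale0r subrr normr0 mulr0.
have same a b : t k <= a -> a <= b -> b <= t k.+1 -> `|slope k - w| <= M ->
    `|pwlinear N t y b - pwlinear N t y a - (b - a) *: w| <= M * (b - a).
  move=> ka ab bk kM.
  rewrite (pwlinearE kN ka (le_trans ab bk)) (pwlinearE kN (le_trans ka ab) bk).
  rewrite opprD addrACA subrr add0r -scalerBl opprB addrA subrK -scalerBr normrZ.
  by rewrite ger0_norm ?subr_ge0// mulrC ler_wpM2r// subr_ge0.
have [rk'|kr] := leP r (t k); first by apply: ih => //; exact: ltnW.
have [ks|sk] := leP (t k) s.
  by apply: same => //; apply: hM => //; [exact: ltW|exact: le_trans sr rk].
have -> : pwlinear N t y r - pwlinear N t y s - (r - s) *: w =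
   (pwlinear N t y r - pwlinear N t y (t k) - (r - t k) *: w) +
   (pwlinear N t y (t k) - pwlinear N t y s - (t k - s) *: w).
  by rewrite addrACA -opprD -scalerDl !addrA !subrK.
apply: le_trans (ler_normD _ _) _.
have -> : M * (r - s) = M * (r - t k) + M * (t k - s) by ring.
apply: lerD.
  by apply: same => //; [exact: ltW|apply: hM => //; [exact: ltW|exact: le_trans sr rk]].
apply: ih => //; [exact: ltW|exact: ltnW|] => i iN tir sti.
by apply: hM => //; apply: le_trans tir (ltW kr).
Qed.

End Partitions.

(** * Continuity, derivatives and mean values of real functions *)

Section RealFunctions.
Variable R : realType.
Implicit Types (f g : R -> R) (a b s d C S : R).

Lemma lipschitz_within_continuous f S a b : 0 <= S ->
  (forall x x', a <= x <= b -> a <= x' <= b -> `|f x - f x'| <= S * `|x - x'|) ->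
  {within `[a, b], continuous f}.
Proof.
move=> S0 fS; apply/subspace_continuousP => x /=; rewrite in_itv /= => xab.
apply/cvgrPdist_le => e e0; rewrite near_withinE; near=> r.
rewrite /= in_itv /= => rab; apply: le_trans (fS _ _ xab rab) _.
apply: (@le_trans _ _ ((S + 1) * (e / (S + 1)))); last first.
  by rewrite mulrC divfK// lt0r_neq0// ltr_wpDl.
apply: ler_pM => //; first by rewrite lerDl.
near: r; apply: (@cvgr_dist_le _ _ _ _ _ (fun r : R => r)); first exact: cvg_id.
by rewrite divr_gt0// ltr_wpDl.
Unshelve. all: by end_near. Qed.

Lemma within_continuous_bounded f a b : a <= b ->
  {within `[a, b], continuous f} -> exists2 M, 0 <= M & forall s, a <= s <= b -> `|f s| <= M.
Proof.
move=> ab cf; have [c1 _ h1] := EVT_max ab cf; have [c2 _ h2] := EVT_min ab cf.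
exists (`|f c1| + `|f c2|); first by rewrite addr_ge0.
move=> s sab; have := h1 s; have := h2 s; rewrite in_itv /= => /(_ sab) l2 /(_ sab) l1.
have := ler_norm (f c1); have := ler_norm (- f c2); rewrite normrN => n2 n1.
have := normr_ge0 (f c1); have := normr_ge0 (f c2) => p2 p1.
by rewrite ler_norml; apply/andP; split; lra.
Qed.

Lemma is_derive_quadratic_error f d C a b s : a < s < b ->
  (forall r, a < r < b -> `|f r - f s - (r - s) * d| <= C * (r - s) ^+ 2) ->
  is_derive s 1 f d.
Proof.
move=> /andP[as_ sb] fC.
have C0 : 0 <= C.
  have h : a < (s + b) / 2 < b by apply/andP; split; lra.
  have := le_trans (normr_ge0 _) (fC _ h); rewrite pmulr_lge0//.
  by rewrite exprn_even_gt0//= subr_eq0; apply/eqP; lra.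
suff cv : h^-1 *: (f (h *: 1 + s) - f s) @[h --> 0^'] --> d.
  by apply: DeriveDef; [apply/cvg_ex; exists d|exact: cvg_lim].
apply/cvgrPdist_le => e e0; near=> h.
have h0 : h != 0 by near: h; exact: nbhs_dnbhs_neq.
have hs : `|h| < s - a by near: h; apply: dnbhs0_lt; rewrite subr_gt0.
have hb : `|h| < b - s by near: h; apply: dnbhs0_lt; rewrite subr_gt0.
have he : `|h| <= e / (C + 1).
  by near: h; apply: dnbhs0_le; rewrite divr_gt0// ltr_wpDl.
have ab : a < h + s < b.
  by move: hs hb; rewrite !ltr_norml => /andP[? ?] /andP[? ?]; apply/andP; split; lra.
have := fC _ ab; rewrite addrK => hC.
rewrite [h *: 1]mulr1 [_ *: _]mulrC.
have -> : d - (f (h + s) - f s) / h = - (f (h + s) - f s - h * d) / h by field.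
rewrite normrM normrN normfV ler_pdivrMr ?normr_gt0//.
apply: le_trans hC _; rewrite -real_normK ?num_real// expr2 mulrA ler_wpM2r//.
apply: (@le_trans _ _ ((C + 1) * (e / (C + 1)))).
  by apply: ler_pM => //; rewrite lerDl.
by rewrite mulrC divfK// lt0r_neq0// ltr_wpDl.
Unshelve. all: by end_near. Qed.

Lemma mean_value_error f df (w M T s r : R) :
  (forall x, x \in `]0, T[ -> is_derive x 1 f (df x)) ->
  {within `[0, T], continuous f} -> 0 <= s -> s <= r -> r <= T ->
  (forall x, s <= x <= r -> `|df x - w| <= M) ->
  `|f r - f s - (r - s) * w| <= M * (r - s).
Proof.
move=> fd cf s0 sr rT dfM.
have fd' x : x \in `]s, r[ -> is_derive x 1 f (df x).
  rewrite in_itv /= => /andP[sx xr]; apply: fd.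
  by rewrite in_itv /= (le_lt_trans s0 sx) (lt_le_trans xr rT).
have cf' : {within `[s, r], continuous f}.
  apply: continuous_subspaceW cf => x /=; rewrite !in_itv /= => /andP[sx xr].
  by rewrite (le_trans s0 sx) (le_trans xr rT).
have [x xsr ->] := MVT_segment sr fd' cf'.
rewrite mulrC -mulrBr normrM ger0_norm ?subr_ge0// mulrC ler_wpM2r ?subr_ge0//.
exact: dfM.
Qed.

End RealFunctions.

(** * The oscillator system: comparison with the scheme, existence and uniqueness *)

Section Oscillator.
Variables (R : realType) (m nu kappa lambda c : R).
Hypotheses (m_gt0 : 0 < m) (nu_gt0 : 0 < nu) (kappa_gt0 : 0 < kappa)
    (lambda_gt0 : 0 < lambda) (c_gt0 : 0 < c).
Local Notation vfield := (vfield m nu kappa lambda c).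
Local Notation scheme_sol := (scheme_sol m nu kappa lambda c).
Local Notation oscillator_sol := (oscillator_sol m nu kappa lambda c).
Local Notation approx_sol := (approx_sol vfield).

Lemma vfield0 : vfield 0 = 0.
Proof.
apply: vec3P; rewrite vec3E /qof /pof /thof !mxE.
- by rewrite mul0r.
- by ring.
- by rewrite expr0n !mulr0 !mul0r addr0.
Qed.

(** The temperature equation is quadratic, so L grows with B; the factor 2 B comes from p^2 - p'^2
    and from splitting the difference of the products p theta. *)
Lemma vfield_lipschitz (B : R) : 0 <= B ->
  exists2 L, 0 <= L & lipschitz_ball vfield B L.
Proof.
move=> B0.
pose al := nu / (m ^+ 2 * c); pose be := lambda / (m * c).
have al0 : 0 < al by rewrite divr_gt0// mulr_gt0// exprn_gt0.
have be0 : 0 < be by rewrite divr_gt0// mulr_gt0.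
have im0 : 0 < m^-1 by rewrite invr_gt0.
have num0 : 0 < nu / m by rewrite divr_gt0.
pose L := m^-1 + nu / m + kappa + lambda + 2 * B * (al + be).
have ab0 : 0 <= 2 * B * (al + be).
  by apply: mulr_ge0; [exact: mulr_ge0|rewrite ltW// addr_gt0].
exists L; first by apply: addr_ge0 => //; rewrite !addr_ge0// ltW.
move=> x x' xB x'B; set D := `|x - x'|.
have D0 : 0 <= D by exact: normr_ge0.
have hq : `|qof x - qof x'| <= D by have := qof_le_norm (x - x'); rewrite !compE.
have hp : `|pof x - pof x'| <= D by have := pof_le_norm (x - x'); rewrite !compE.
have ht : `|thof x - thof x'| <= D by have := thof_le_norm (x - x'); rewrite !compE.
have px := le_trans (pof_le_norm x) xB; have px' := le_trans (pof_le_norm x') x'B.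
have tx' := le_trans (thof_le_norm x') x'B.
have P1 : `|m^-1 * (pof x - pof x')| <= m^-1 * D by exact: ler_norm_pM.
have P2 : `|nu / m * (pof x - pof x')| <= nu / m * D by exact: ler_norm_pM.
have P3 : `|kappa * (qof x - qof x')| <= kappa * D by exact: ler_norm_pM.
have P4 : `|lambda * (thof x - thof x')| <= lambda * D by exact: ler_norm_pM.
have P5 : `|al * ((pof x + pof x') * (pof x - pof x'))| <= al * (2 * B * D).
  apply: ler_norm_pM => //; rewrite normrM; apply: ler_pM => //.
  by apply: le_trans (ler_normD _ _) _; lra.
have P6 : `|be * (pof x * (thof x - thof x') + thof x' * (pof x - pof x'))| <= be * (2 * B * D).
  apply: ler_norm_pM => //; apply: le_trans (ler_normD _ _) _; rewrite !normrM.
  have -> : 2 * B * D = B * D + B * D by ring.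
  by apply: lerD; apply: ler_pM.
have Q1 : 0 <= m^-1 * D by rewrite mulr_ge0// ltW.
have Q2 : 0 <= nu / m * D by rewrite mulr_ge0// ltW.
have Q3 : 0 <= kappa * D by rewrite mulr_ge0// ltW.
have Q4 : 0 <= lambda * D by rewrite mulr_ge0// ltW.
have BD0 : 0 <= 2 * B * D by rewrite mulr_ge0// mulr_ge0.
have Q5 : 0 <= al * (2 * B * D) by rewrite mulr_ge0// ltW.
have Q6 : 0 <= be * (2 * B * D) by rewrite mulr_ge0// ltW.
have -> : L * D = m^-1 * D + nu / m * D + kappa * D + lambda * D
   + al * (2 * B * D) + be * (2 * B * D) by rewrite /L; ring.
apply: cV3_norm_le; rewrite !compE !vec3E.
- have -> : pof x / m - pof x' / m = m^-1 * (pof x - pof x') by ring.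
  by apply: le_trans P1 _; lra.
- have -> : - (nu * pof x / m) - kappa * qof x - lambda * thof x
      - (- (nu * pof x' / m) - kappa * qof x' - lambda * thof x') =
      - (nu / m * (pof x - pof x')) - kappa * (qof x - qof x')
      - lambda * (thof x - thof x') by ring.
  apply: le_trans (ler_normB _ _) _.
  have := ler_normB (- (nu / m * (pof x - pof x'))) (kappa * (qof x - qof x')).
  rewrite normrN; lra.
- have -> : nu * pof x ^+ 2 / (m ^+ 2 * c) + lambda * pof x * thof x / (m * c)
     - (nu * pof x' ^+ 2 / (m ^+ 2 * c) + lambda * pof x' * thof x' / (m * c)) =
     al * ((pof x + pof x') * (pof x - pof x'))
     + be * (pof x * (thof x - thof x') + thof x' * (pof x - pof x')).
    by rewrite /al /be; ring.
  by apply: le_trans (ler_normD _ _) _; lra.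
Qed.

Lemma vfield_bound (B L : R) x : 0 <= B -> lipschitz_ball vfield B L -> `|x| <= B ->
  `|vfield x| <= L * `|x|.
Proof.
move=> B0 FL xB; have := FL x 0 xB; rewrite normr0 vfield0 !subr0; exact.
Qed.

(** Here the bound on [z] comes from continuity on a compact interval and depends on the solution,
    which is enough for uniqueness. *)
Lemma oscillator_approx T y0 z : 0 < T -> oscillator_sol T y0 z ->
  exists B A, [/\ 0 <= B, 0 <= A & approx_sol T B A 0 z].
Proof.
move=> T0 [_ [cq [cp ct]] zd].
have [Bq Bq0 hq] := within_continuous_bounded (ltW T0) cq.
have [Bp Bp0 hp] := within_continuous_bounded (ltW T0) cp.
have [Bt Bt0 ht] := within_continuous_bounded (ltW T0) ct.
pose B := Bq + Bp + Bt.
have B0 : 0 <= B by rewrite !addr_ge0.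
have zB s : 0 <= s <= T -> `|z s| <= B.
  move=> sT; have := hq s sT; have := hp s sT; have := ht s sT => h1 h2 h3.
  by apply: cV3_norm_le; rewrite /B; lra.
have [L L0 FL] := vfield_lipschitz B0.
have mv w M s r : 0 <= M -> 0 <= s -> s <= r -> r <= T ->
    (forall x, s <= x <= r -> `|vfield (z x) - w| <= M) ->
    `|z r - z s - (r - s) *: w| <= M * (r - s).
  move=> M0 s0 sr rT zM.
  have err f g : (forall x, s <= x <= r -> `|f (vfield (z x)) - f w| <= M) ->
      (forall x, x \in `]0, T[ -> is_derive x 1 g (f (vfield (z x)))) ->
      {within `[0, T], continuous g} ->
      `|g r - g s - (r - s) * f w| <= M * (r - s).
    move=> fM gd cg.
    exact: (@mean_value_error _ g (fun x => f (vfield (z x))) (f w) M T).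
  apply: cV3_norm_le; rewrite !compE.
  - apply: (err (@qof R) (fun s => qof (z s))) => // x xsr.
      by have := le_trans (qof_le_norm _) (zM x xsr); rewrite !compE.
    by have [+ _ _] := zd x xsr; rewrite vec3E.
  - apply: (err (@pof R) (fun s => pof (z s))) => // x xsr.
      by have := le_trans (pof_le_norm _) (zM x xsr); rewrite !compE.
    by have [_ + _] := zd x xsr; rewrite vec3E.
  - apply: (err (@thof R) (fun s => thof (z s))) => // x xsr.
      by have := le_trans (thof_le_norm _) (zM x xsr); rewrite !compE.
    by have [_ _ +] := zd x xsr; rewrite vec3E.
have FB s : 0 <= s <= T -> `|vfield (z s)| <= L * B.
  move=> sT; apply: le_trans (vfield_bound B0 FL (zB s sT)) _.
  by rewrite ler_wpM2l// zB.
(* The mean value estimate is used twice: with w = 0 it makes [z] Lipschitz with constant L B, so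
   the field along [z] is Lipschitz with constant L (L B). *)
exists B, (L * (L * B)); split; [by []|by rewrite !mulr_ge0|split=> // s r s0 sr rT].
rewrite addr0 mulrAC.
have rs0 : 0 <= r - s by rewrite subr_ge0.
apply: (mv) => // [|x /andP[sx xr]]; first by rewrite !mulr_ge0.
have xT := le_trans xr rT; have x0 := le_trans s0 sx.
apply: le_trans (FL _ _ (zB x _) (zB s _)) _; rewrite ?x0 ?s0 ?xT ?(le_trans sx)//.
rewrite -mulrA ler_wpM2l//.
have h : `|z x - z s| <= L * B * (x - s).
  have := mv 0 (L * B) s x; rewrite scaler0 subr0; apply => //.
    by rewrite mulr_ge0.
  by move=> u /andP[su ux]; rewrite subr0 FB// (le_trans s0 su) (le_trans ux xT).
by apply: le_trans h _; rewrite ler_wpM2l ?mulr_ge0// lerD2r.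
Qed.

Lemma approx_sol_lipschitz T B A z : 0 <= T -> 0 <= B -> 0 <= A ->
  approx_sol T B A 0 z -> exists2 S, 0 <= S &
    forall s r, 0 <= s <= T -> 0 <= r <= T -> `|z s - z r| <= S * `|s - r|.
Proof.
move=> T0 B0 A0 [zB zA]; have [L L0 FL] := vfield_lipschitz B0.
have S0 : 0 <= L * B + A * T by rewrite addr_ge0// mulr_ge0.
exists (L * B + A * T) => //.
have lip_le s r : 0 <= s -> s <= r -> r <= T -> `|z r - z s| <= (L * B + A * T) * (r - s).
  move=> s0 sr rT; have rs0 : 0 <= r - s by rewrite subr_ge0.
  have sT : 0 <= s <= T by rewrite s0 (le_trans sr).
  rewrite -[z r - z s](subrK ((r - s) *: vfield (z s))).
  apply: le_trans (ler_normD _ _) _; rewrite mulrDl addrC; apply: lerD.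
    rewrite normrZ ger0_norm// mulrC ler_wpM2r//.
    apply: le_trans (vfield_bound B0 FL (zB s sT)) _.
    by rewrite ler_wpM2l// zB.
  apply: le_trans (zA s r s0 sr rT) _; rewrite addr0 mulrAC ler_wpM2r//.
  by rewrite ler_wpM2l//; lra.
move=> s r /andP[s0 sT] /andP[r0 rT]; have [sr|rs] := leP s r.
  by rewrite distrC [`|s - r|]distrC [`|r - s|]ger0_norm ?subr_ge0// lip_le.
by rewrite [`|s - r|]ger0_norm ?subr_ge0 ?lip_le ?(ltW rs).
Qed.

(** [approx_sol] controls only increments forward in time. For r < s the increment is taken from r,
    and exchanging the field at r for the field at s costs L S (s - r)^2; hence the constant A + L S
    of the quadratic error. *)
Lemma approx_oscillator T B A y0 z : 0 < T -> 0 <= B -> 0 <= A -> z 0 = y0 ->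
  approx_sol T B A 0 z -> oscillator_sol T y0 z.
Proof.
move=> T0 B0 A0 z0 zBA; have [zB zA] := zBA.
have [L L0 FL] := vfield_lipschitz B0.
have [S S0 lip] := approx_sol_lipschitz (ltW T0) B0 A0 zBA.
have cont (f : 'cV[R]_3 -> R) : (forall u v, `|f u - f v| <= `|u - v|) ->
    {within `[0, T], continuous (fun s => f (z s))}.
  move=> f1; apply: (@lipschitz_within_continuous _ _ S) => // x x' xT x'T.
  exact: le_trans (f1 _ _) (lip _ _ xT x'T).
have hq (u v : 'cV[R]_3) : `|qof u - qof v| <= `|u - v| by have := qof_le_norm (u - v); rewrite !compE.
have hp (u v : 'cV[R]_3) : `|pof u - pof v| <= `|u - v| by have := pof_le_norm (u - v); rewrite !compE.
have ht (u v : 'cV[R]_3) : `|thof u - thof v| <= `|u - v| by have := thof_le_norm (u - v); rewrite !compE.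
split=> //; first by split; [exact: cont|split; exact: cont].
move=> s; rewrite in_itv /= => /andP[s0 sT].
have sT' : 0 <= s <= T by rewrite !ltW.
pose C := A + L * S.
have err r : 0 < r < T -> `|z r - z s - (r - s) *: vfield (z s)| <= C * (r - s) ^+ 2.
  move=> /andP[r0 rT]; have rT' : 0 <= r <= T by rewrite !ltW.
  have [sr|/ltW rs] := leP s r.
    apply: le_trans (zA s r (ltW s0) sr (ltW rT)) _.
    by rewrite addr0 -mulrA -expr2 ler_wpM2r ?sqr_ge0// lerDl mulr_ge0.
  have sr0 : 0 <= s - r by rewrite subr_ge0.
  have -> : z r - z s - (r - s) *: vfield (z s) =
     - (z s - z r - (s - r) *: vfield (z r)) + (s - r) *: (vfield (z s) - vfield (z r)).
    by move: (vfield _) (vfield _) => u v; apply: vec3P; rewrite !compE; ring.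
  apply: le_trans (ler_normD _ _) _; rewrite normrN /C mulrDl; apply: lerD.
    apply: le_trans (zA r s (ltW r0) rs (ltW sT)) _.
    by rewrite addr0 -mulrA -expr2 -(opprB s r) sqrrN.
  rewrite normrZ ger0_norm// -(opprB s r) sqrrN expr2 mulrCA ler_wpM2l//.
  apply: le_trans (FL _ _ (zB _ sT') (zB _ rT')) _; rewrite -mulrA ler_wpM2l//.
  by have := lip _ _ sT' rT'; rewrite [`|s - r|]ger0_norm.
have s0T : 0 < s < T by rewrite s0 sT.
split.
- have := @is_derive_quadratic_error _ (fun s => qof (z s)) (qof (vfield (z s))) C 0 T s s0T.
  rewrite vec3E; apply => r /err /(le_trans (qof_le_norm _)).
  by rewrite !compE vec3E.
- have := @is_derive_quadratic_error _ (fun s => pof (z s)) (pof (vfield (z s))) C 0 T s s0T.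
  rewrite vec3E; apply => r /err /(le_trans (pof_le_norm _)).
  by rewrite !compE vec3E.
- have := @is_derive_quadratic_error _ (fun s => thof (z s)) (thof (vfield (z s))) C 0 T s s0T.
  rewrite vec3E; apply => r /err /(le_trans (thof_le_norm _)).
  by rewrite !compE vec3E.
Qed.

(** All that the limit passage needs to know about the scheme: the approximate solution property
    yields uniform closeness to the solution, the last estimate closeness of the slopes to its
    derivative. *)
Lemma scheme_approx T y0 : 0 < T -> 0 < thof y0 -> exists B thmin A S : R,
  [/\ [/\ 0 < B, 0 < thmin, 0 <= A & 0 <= S] &
  forall N t (y : nat -> 'cV[R]_3), is_partition T N t -> scheme_sol N t y0 y ->
    [/\ forall i, (i <= N)%N -> `|y i| <= B /\ thmin <= thof (y i),
        forall i, (i < N)%N -> `|slope t y i| <= S,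
        approx_sol T B A (Num.sqrt (mesh N t)) (pwlinear N t y) &
        forall i s, (i < N)%N -> t i <= s -> s <= t i.+1 ->
          `|slope t y i - vfield (pwlinear N t y s)| <= A * Num.sqrt (mesh N t)]].
Proof.
move=> T0 th0.
have [B [thmin [K [B0 thmin0 K0 est]]]] :=
  scheme_estimates m_gt0 nu_gt0 kappa_gt0 lambda_gt0 c_gt0 th0.
have [L L0 FL] := vfield_lipschitz (ltW B0).
pose sT := Num.sqrt T; have sT0 : 0 <= sT by exact: sqrtr_ge0.
pose S := L * B + K * sT; pose A := K + L * S + L * S * sT.
have S0 : 0 <= S by apply: addr_ge0; apply: mulr_ge0 => //; exact: ltW.
have LS0 : 0 <= L * S by exact: mulr_ge0.
have LST0 : 0 <= L * S * sT by exact: mulr_ge0.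
have A0 : 0 <= A by rewrite /A !addr_ge0.
exists B, thmin, A, S; split=> // N t y pt sy.
have [bnd cons] := est _ _ _ _ pt sy.
set e := Num.sqrt (mesh N t).
have e0 : 0 <= e by exact: sqrtr_ge0.
have ee : mesh N t = e ^+ 2 by rewrite sqr_sqrtr// mesh_ge0.
have esT : e <= sT by rewrite ler_wsqrtr// mesh_leT// ltW.
(* Errors of first order in the mesh are absorbed into the order of its square root at the price of
   a factor sqrt T. *)
have mesh_e : mesh N t <= sT * e by rewrite ee expr2 ler_wpM2r.
have cons' i : (i < N)%N -> `|slope t y i - vfield (y i.+1)| <= K * e.
  by move=> iN; apply: le_trans (cons i iN) _; rewrite ler_wpM2l// ler_wsqrtr// mesh_ge.
have slopeS i : (i < N)%N -> `|slope t y i| <= S.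
  move=> iN; rewrite -(subrK (vfield (y i.+1)) (slope t y i)).
  apply: le_trans (ler_normD _ _) _; rewrite /S addrC; apply: lerD.
    have [yB _] := bnd _ iN.
    by apply: le_trans (vfield_bound (ltW B0) FL yB) _; rewrite ler_wpM2l.
  by apply: le_trans (cons' i iN) _; rewrite ler_wpM2l.
have pB s : 0 <= s <= T -> `|pwlinear N t y s| <= B.
  move=> /andP[]; rewrite le_eqVlt => /predU1P[<- _|s0 sT'].
    by rewrite (pwlinear0 pt); have [] := bnd 0%N isT.
  have [i [iN ts st]] := in_cell pt s0 sT'.
  have d0 : 0 < t i.+1 - t i by rewrite subr_gt0 (partition_lt pt).
  rewrite /pwlinear (cellE pt iN ts st).
  apply: le_trans (ler_normD _ _) _; rewrite (normrZ _ (y i.+1)) (normrZ _ (y i)).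
  have a1 : 0 <= (s - t i) / (t i.+1 - t i) by rewrite divr_ge0 ?(ltW d0)// subr_ge0 ltW.
  have a2 : 0 <= (t i.+1 - s) / (t i.+1 - t i) by rewrite divr_ge0 ?(ltW d0)// subr_ge0.
  rewrite (ger0_norm a1) (ger0_norm a2).
  have [y1 _] := bnd _ iN; have [y2 _] := bnd _ (ltnW iN).
  have -> : B = (s - t i) / (t i.+1 - t i) * B + (t i.+1 - s) / (t i.+1 - t i) * B.
    by field; rewrite lt0r_neq0.
  by apply: lerD; rewrite ler_wpM2l.
have lip s r : 0 <= s -> s <= r -> r <= T ->
    `|pwlinear N t y r - pwlinear N t y s| <= S * (r - s).
  move=> s0 sr rT.
  have := @pwlinear_mean_value _ _ _ _ pt y 0 S s r S0 s0 sr rT.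
  rewrite scaler0 subr0; apply => i iN _ _; rewrite subr0; exact: slopeS.
(* Here [s] may lie in an earlier cell. The defect at the node [t i.+1] costs [K * e]; moving the
   argument of the field from that node back to [s] costs [L * S * (t i.+1 - s)]. *)
have key i s : (i < N)%N -> 0 <= s -> s <= t i.+1 ->
    `|slope t y i - vfield (pwlinear N t y s)| <= K * e + L * S * (t i.+1 - s).
  move=> iN s0 st; have tT := partition_leT pt iN.
  rewrite -(subrK (vfield (y i.+1)) (slope t y i)) -addrA.
  apply: le_trans (ler_normD _ _) _; apply: lerD; first exact: cons'.
  have [yB _] := bnd _ iN.
  apply: le_trans (FL _ _ yB (pB s _)) _; first by rewrite s0 (le_trans st).
  rewrite -mulrA ler_wpM2l// -{1}(pwlinear_nodeS pt y iN).
  exact: lip.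
split=> //.
  split=> // s r s0 sr rT; have rs0 : 0 <= r - s by rewrite subr_ge0.
  rewrite mulrAC.
  apply: (@pwlinear_mean_value _ _ _ _ pt) => //.
    by rewrite mulr_ge0// addr_ge0.
  move=> i iN tr st; apply: le_trans (key i s iN s0 st) _.
  have h1 : t i.+1 - s <= (r - s) + sT * e.
    by have := mesh_ge t iN; move: mesh_e tr; lra.
  apply: (@le_trans _ _ (K * e + L * S * ((r - s) + sT * e))).
    by rewrite lerD2l ler_wpM2l.
  rewrite -subr_ge0 (_ : _ - _ = (K + L * S * sT) * (r - s) + L * S * e); last first.
    by rewrite /A; ring.
  by rewrite !addr_ge0// mulr_ge0// addr_ge0.
move=> i s iN ts st.
apply: le_trans (key i s iN (le_trans (partition_ge0 pt (ltnW iN)) ts) st) _.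
have h1 : t i.+1 - s <= sT * e by have := mesh_ge t iN; move: mesh_e ts; lra.
apply: (@le_trans _ _ (K * e + L * S * (sT * e))); first by rewrite lerD2l ler_wpM2l.
rewrite -subr_ge0 (_ : _ - _ = L * S * e); first by rewrite mulr_ge0.
by rewrite /A; ring.
Qed.

Definition uniform_part T n (i : nat) : R := i%:R * (T / n.+1%:R).

Lemma uniform_partP T n : 0 < T -> is_partition T n.+1 (uniform_part T n).
Proof.
move=> T0; split=> [||i _]; rewrite /uniform_part ?mul0r//.
  by rewrite mulrC divfK.
by rewrite ltr_pM2r ?divr_gt0// ltr_nat.
Qed.

Lemma mesh_uniform_part T n : 0 < T -> mesh n.+1 (uniform_part T n) <= T / n.+1%:R.
Proof.
move=> T0; have h : 0 <= T / n.+1%:R by rewrite divr_ge0 ?ltW.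
apply: bigmax_le => // i _.
by rewrite /uniform_part -mulrBl -natr1 addrAC subrr add0r mul1r.
Qed.

(** The solution is the limit of the scheme itself on uniform partitions. As the field is only
    locally Lipschitz, it is the a priori bounds on the scheme that rule out blow-up before T. *)
Lemma oscillator_exists T y0 : 0 < T -> 0 < thof y0 ->
  exists z, oscillator_sol T y0 z /\ exists B A, [/\ 0 <= B, 0 <= A & approx_sol T B A 0 z].
Proof.
move=> T0 th0.
have [B [thm [A [S [[/ltW B0 _ A0 _] est]]]]] := scheme_approx T0 th0.
have [L L0 FL] := vfield_lipschitz B0.
have /choice[y sy] n := scheme_exists m_gt0 nu_gt0 kappa_gt0 lambda_gt0 c_gt0 th0
  (uniform_partP n T0).
pose w n := pwlinear n.+1 (uniform_part T n) (y n).
pose e n := Num.sqrt (mesh n.+1 (uniform_part T n)).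
have e0 n : 0 <= e n by exact: sqrtr_ge0.
have e_small d : 0 < d -> exists n, e n <= d.
  move=> d0; have [n nd] := @exists_inv_lt R T (d ^+ 2) (exprn_gt0 _ d0).
  exists n; rewrite -[d]gtr0_norm// -sqrtr_sqr ler_wsqrtr//.
  exact: le_trans (mesh_uniform_part n T0) nd.
have wA n : approx_sol T B A (e n) (w n).
  by have [] := est _ _ _ (uniform_partP n T0) (sy n).
have w0 n : w n 0 = y0.
  by rewrite /w (pwlinear0 (uniform_partP n T0)); have [] := sy n.
pose C := T * A * expR (L * T).
have C0 : 0 <= C by rewrite !mulr_ge0 ?expR_ge0// ltW.
have ww s n k : 0 <= s <= T -> `|w n s - w k s| <= C * e n + C * e k.
  move=> sT; rewrite -mulrDr.
  by apply: approx_sol_dist (wA n) (wA k) _ _ sT => //; rewrite !w0.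
(* The limit is taken pointwise and by components; the value outside [0, T] is arbitrary. *)
have lim s : exists v, 0 <= s <= T -> forall n, `|w n s - v| <= C * e n.
  have [sT|] := boolP (0 <= s <= T); last by exists 0.
  have comp (f : 'cV[R]_3 -> R) : (forall u v, `|f u - f v| <= `|u - v|) ->
      exists l, forall n, `|f (w n s) - l| <= C * e n.
    move=> f1; apply: mutually_close_limit => n k.
    exact: le_trans (f1 _ _) (ww s n k sT).
  have [|lq hq] := comp (@qof R).
    by move=> u v; have := qof_le_norm (u - v); rewrite !compE.
  have [|lp hp] := comp (@pof R).
    by move=> u v; have := pof_le_norm (u - v); rewrite !compE.
  have [|lt ht] := comp (@thof R).
    by move=> u v; have := thof_le_norm (u - v); rewrite !compE.
  by exists (vec3 lq lp lt) => _ n; apply: cV3_norm_le; rewrite !compE vec3E.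
have [z zw] := choice lim.
have zB s : 0 <= s <= T -> `|z s| <= B.
  move=> sT; apply: (le_add_small C0 e_small) => n.
  have [wB _] := wA n; rewrite -[z s](subrK (w n s)) addrC.
  apply: le_trans (ler_normD _ _) _; apply: lerD; first exact: wB.
  by rewrite distrC zw.
have zA : approx_sol T B A 0 z.
  split=> // s r s0 sr rT; rewrite addr0.
  have rs0 : 0 <= r - s by rewrite subr_ge0.
  have sT : 0 <= s <= T by rewrite s0 (le_trans sr).
  have rT' : 0 <= r <= T by rewrite (le_trans s0).
  pose D := 2 * C + T * L * C + A * T.
  have TLC0 : 0 <= T * L * C by rewrite !mulr_ge0// ltW.
  have AT0 : 0 <= A * T by rewrite !mulr_ge0// ltW.
  have D0 : 0 <= D by rewrite /D !addr_ge0// mulr_ge0.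
  apply: (le_add_small D0 e_small) => n.
  have [wB wAn] := wA n.
  (* The one-step error of [w n] supplies A (r - s)^2; everything else is at most [D * e n]. *)
  have -> : z r - z s - (r - s) *: vfield (z s) =
     (w n r - w n s - (r - s) *: vfield (w n s))
     - (w n r - z r) + (w n s - z s) + (r - s) *: (vfield (w n s) - vfield (z s)).
    by move: (vfield _) (vfield _) => u v; apply: vec3P; rewrite !compE; ring.
  have h1 := wAn s r s0 sr rT.
  have h2 := zw r rT' n; have h3 := zw s sT n.
  have h4 : `|(r - s) *: (vfield (w n s) - vfield (z s))| <= T * L * C * e n.
    rewrite normrZ ger0_norm// (_ : T * L * C * e n = T * (L * (C * e n))); last by ring.
    apply: ler_pM => //; first lra.
    by apply: le_trans (FL _ _ (wB s sT) (zB s sT)) _; rewrite ler_wpM2l.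
  have h5 : A * (r - s) * (r - s + e n) <= A * (r - s) * (r - s) + A * T * e n.
    rewrite mulrDr lerD2l ler_wpM2r// ler_wpM2l//; lra.
  apply: le_trans (ler_normD _ _) _; rewrite /D.
  have := ler_normD (w n r - w n s - (r - s) *: vfield (w n s) - (w n r - z r)) (w n s - z s).
  have := ler_normB (w n r - w n s - (r - s) *: vfield (w n s)) (w n r - z r).
  move: h1 h2 h3 h4 h5; lra.
have z0 : z 0 = y0.
  apply/eqP; rewrite -subr_eq0 -normr_le0; apply: (le_add_small C0 e_small) => n.
  by rewrite distrC -(w0 n) add0r zw// lexx ltW.
exists z; split; last by exists B, A.
exact: approx_oscillator zA.
Qed.

(** Both solutions are approximate solutions with error 0 once their constants are enlarged to
    common ones, and the distance estimate then has right-hand side 0. *)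
Lemma oscillator_unique T y0 z1 z2 : 0 < T ->
  oscillator_sol T y0 z1 -> oscillator_sol T y0 z2 ->
  forall s, 0 <= s <= T -> z1 s = z2 s.
Proof.
move=> T0 s1 s2 s sT.
have [B1 [A1 [B10 A10 a1]]] := oscillator_approx T0 s1.
have [B2 [A2 [B20 A20 a2]]] := oscillator_approx T0 s2.
have B12 : 0 <= B1 + B2 by rewrite addr_ge0.
have [L L0 FL] := vfield_lipschitz B12.
have z12 : z1 0 = z2 0 by have [-> _ _] := s1; have [-> _ _] := s2.
have b1 : approx_sol T (B1 + B2) (A1 + A2) 0 z1.
  by apply: approx_sol_le a1; rewrite ?lerDl ?addr_ge0.
have b2 : approx_sol T (B1 + B2) (A1 + A2) 0 z2.
  by apply: approx_sol_le a2; rewrite ?lerDr ?addr_ge0.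
have := approx_sol_dist L0 (addr_ge0 A10 A20) FL (lexx 0) (lexx 0) b1 b2 z12 sT.
by rewrite addr0 mulr0 normr_le0 subr_eq0 => /eqP.
Qed.

End Oscillator.

(** * Sobolev norms and weak derivatives *)

Section L2Bounds.
Variable R : realType.
Local Notation mu := (@lebesgue_measure R).
Implicit Types (u g : R -> 'cV[R]_3) (T M K : R).

Lemma measurable_find_step (t : nat -> R) (s : seq nat) (a : nat -> R) :
  measurable_fun [set: R] (fun x => a (find (fun i => x <= t i) s)).
Proof.
elim: s a => [|i s ih] a /=; first exact: measurable_cst.
have -> : (fun x => a (if x <= t i then 0%N else (find (fun i => x <= t i) s).+1)) =
    (fun x => if x <= t i then a 0%N else a (find (fun i => x <= t i) s).+1).
  by apply/funext => x; case: ifP.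
apply: measurable_fun_ifT; last exact: (ih (fun k => a k.+1)).
  by apply: measurable_fun_ler; [exact: measurable_id|exact: measurable_cst].
exact: measurable_cst.
Qed.

Lemma measurable_cell_step N (t : nat -> R) (a : nat -> R) (D : set R) :
  measurable_fun D (fun x => a (cell N t x)).
Proof.
apply: (@measurable_funS _ _ _ _ [set: R]) => //.
exact: (measurable_find_step t (iota 0 N.+1) a).
Qed.

Lemma measurable_enorm u (D : set R) :
  (forall i, measurable_fun D (fun s => u s i 0)) -> measurable_fun D (fun s => enorm (u s)).
Proof.
move=> mu_; apply: measurableT_comp.
  by apply: continuous_measurable_fun; exact: sqrt_continuous.
have -> : (fun s => dot (u s) (u s)) =
    (fun s => u s 0 0 * u s 0 0 + u s 1 0 * u s 1 0 + u s 2%R 0 * u s 2%R 0).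
  by apply/funext => s; rewrite dotE.
by apply: measurable_funD; [apply: measurable_funD|]; apply: measurable_funM; exact: mu_.
Qed.

Lemma enorm_ge0 (v : 'cV[R]_3) : 0 <= enorm v.
Proof. exact: sqrtr_ge0. Qed.

(** The factor 2 passes from the sup norm to the Euclidean one; T is the measure of the interval. *)
Lemma L2norm_le T u M : 0 < T -> 0 <= M ->
  (forall i, measurable_fun `]0, T[ (fun s => u s i 0)) ->
  (forall s, 0 < s < T -> `|u s| <= M) ->
  (L2norm T u <= (2 * M * Num.sqrt T)%:E)%E.
Proof.
move=> T0 M0 mu_ uM.
have M20 : 0 <= 2 * M by rewrite mulr_ge0.
have en s : `]0, T[%classic s -> enorm (u s) <= 2 * M.
  move=> /=; rewrite in_itv /= => sT; apply: le_trans (enorm_le_norm _) _.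
  by rewrite ler_pM2l// uM.
rewrite /L2norm unlock /Lnorm.
set I := (\int[mu]_x _)%E.
have IE : (I <= ((2 * M) ^+ 2 * T)%:E)%E.
  rewrite /I.
  pose D : set R := `]0, T[%classic.
  pose f s := (enorm (u s) ^+ 2)%:E.
  rewrite (_ : (fun x => _) = patch (fun=> 0%E) D f); last first.
    apply/funext => x; rewrite /= !patchE; case: ifP => _.
      by rewrite /= ger0_norm ?enorm_ge0// powR_mulrn// enorm_ge0.
    by rewrite /= normr0 powR_mulrn// expr0n.
  rewrite -integral_mkcond.
  have -> : ((2 * M) ^+ 2 * T)%:E = (\int[mu]_(x in D) (cst ((2 * M) ^+ 2)%:E x))%E.
    rewrite integral_cst; last exact: measurable_itv.
    rewrite EFinM; congr (_ * _)%E; symmetry.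
    by apply: etrans (lebesgue_measure_itv `]0, T[) _; rewrite /= lte_fin T0 -EFinB subr0.
  apply: ge0_le_integral => //.
  - exact: measurable_itv.
  - by move=> x _; rewrite /f lee_fin sqr_ge0.
  - apply/measurable_EFinP; apply: measurable_funX; exact: measurable_enorm.
  - by move=> x xT /=; rewrite /f lee_fin lerXn2r ?nnegrE ?enorm_ge0// en.
have I0 : (0 <= I)%E by apply: integral_ge0 => x _; exact: poweR_ge0.
apply: (@le_trans _ _ (((2 * M) ^+ 2 * T)%:E `^ 2^-1)%E).
  apply: gt0_ler_poweR; rewrite ?invr_ge0//.
  - by rewrite in_itv /= I0 leey.
  - by rewrite in_itv /= leey lee_fin mulr_ge0 ?sqr_ge0// ltW.
rewrite poweR_EFin lee_fin powR12_sqrt ?mulr_ge0 ?sqr_ge0 ?(ltW T0)//.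
by rewrite sqrtrM ?sqr_ge0// sqrtr_sqr ger0_norm.
Qed.

Lemma L2_bounded T u M : 0 < T -> 0 <= M ->
  (forall i, measurable_fun `]0, T[ (fun s => u s i 0)) ->
  (forall s, 0 < s < T -> `|u s| <= M) -> L2 T u.
Proof.
by move=> T0 M0 mu_ uM; split=> //; apply: le_lt_trans (L2norm_le T0 M0 mu_ uM) (ltry _).
Qed.

Lemma L2norm_ge0 T u : (0 <= L2norm T u)%E.
Proof. exact: Lnorm_ge0. Qed.

(** One weak derivative is enough, [H1norm] being an infimum; 2 stands for the square root of 2. *)
Lemma H1norm_le T u g K : 0 <= K -> weak_derivative T u g ->
  (L2norm T u <= K%:E)%E -> (L2norm T g <= K%:E)%E -> (H1norm T u <= (2 * K)%:E)%E.
Proof.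
move=> K0 wd uK gK.
apply: (@le_trans _ _ ((L2norm T u `^ 2 + L2norm T g `^ 2) `^ 2^-1)%E).
  by apply: ereal_inf_lbound; exists g.
have sq v : (L2norm T v <= K%:E)%E -> (L2norm T v `^ 2 <= (K ^+ 2)%:E)%E.
  move=> vK; rewrite -powR_mulrn// -poweR_EFin.
  by apply: gt0_ler_poweR => //; rewrite in_itv /= ?L2norm_ge0 ?leey// lee_fin K0.
apply: (@le_trans _ _ (((2 * K) ^+ 2)%:E `^ 2^-1)%E).
  apply: gt0_ler_poweR; rewrite ?invr_ge0//.
  - by rewrite in_itv /= leey adde_ge0// poweR_ge0.
  - by rewrite in_itv /= leey lee_fin sqr_ge0.
  apply: le_trans (leeD (sq _ uK) (sq _ gK)) _.
  rewrite -EFinD lee_fin exprMn; have : 0 <= K ^+ 2 by rewrite sqr_ge0.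
  lra.
by rewrite poweR_EFin lee_fin powR12_sqrt ?sqr_ge0// sqrtr_sqr ger0_norm// mulr_ge0.
Qed.

End L2Bounds.

(** * Integration by parts against test functions *)

Section WeakDerivative.
Variable R : realType.
Local Notation mu := (@lebesgue_measure R).
Implicit Types (T M : R) (f phi : R -> R).

Lemma bounded_integrable_oc T M f : measurable_fun `]0, T] f ->
  (forall s, 0 < s <= T -> `|f s| <= M) -> mu.-integrable `]0, T] (EFin \o f).
Proof.
move=> mf fM; apply: measurable_bounded_integrable => //.
  have /= muT := lebesgue_measure_itv `]0, T].
  apply: (@eq_ind_r _ _ (fun z => z < +oo)%E _ _ muT).
  by case: ifP => _; rewrite ?ltry// -EFinB ltry.
exists M; split; first exact: num_real.
move=> x Mx s; rewrite /= in_itv /= => sT.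
exact: le_trans (fM s sT) (ltW Mx).
Qed.

Lemma test_fun_derivable T phi s : test_fun T phi -> derivable phi s 1.
Proof. by move=> [d _]; exact: (d 0%N). Qed.

Lemma test_fun_derivable1 T phi s : test_fun T phi -> derivable (derive1 phi) s 1.
Proof. by move=> [d _]; exact: (d 1%N). Qed.

Lemma derivable_continuous f : (forall s, derivable f s 1) -> continuous f.
Proof. by move=> df s; apply: differentiable_continuous; exact/derivable1_diffP. Qed.

Lemma test_fun_ends T phi : test_fun T phi -> phi 0 = 0 /\ phi T = 0.
Proof.
move=> [_ [a [b [a0 bT phi0]]]]; split; apply: phi0; rewrite in_itv /= negb_and -!ltNge.
  by rewrite a0.
by rewrite bT orbT.
Qed.

Lemma within_continuous_measurable_oc T f :
  {within `[0, T], continuous f} -> measurable_fun `]0, T] f.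
Proof.
move=> cf; apply: (@measurable_funS _ _ _ _ `[0, T]) => //.
  by move=> x /=; rewrite !in_itv /= => /andP[/ltW -> ->].
exact: subspace_continuous_measurable_fun.
Qed.

(** The derivative [g] may jump at the nodes. The function [h i] is its continuous version on the
    closed cell i, to which classical integration by parts applies. *)
Lemma piecewise_ibp T N (t : nat -> R) (u g : R -> R) (h : nat -> R -> R) M phi :
  0 < T -> is_partition T N t ->
  {within `[0, T], continuous u} ->
  (forall i, (i < N)%N -> {within `[t i, t i.+1], continuous (h i)}) ->
  (forall i, (i < N)%N -> forall s, t i < s < t i.+1 -> is_derive s 1 u (h i s)) ->
  (forall i, (i < N)%N -> forall s, t i < s <= t i.+1 -> g s = h i s) ->
  measurable_fun `]0, T] g -> (forall s, 0 < s <= T -> `|g s| <= M) ->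
  test_fun T phi ->
  \int[mu]_(s in `]0, T[) (u s * derive1 phi s) = - \int[mu]_(s in `]0, T[) (g s * phi s).
Proof.
move=> T0 pt cu ch du gh mg gM tphi.
have cphi : continuous phi by apply: derivable_continuous => s; exact: test_fun_derivable tphi.
have cphi' : continuous (derive1 phi).
  by apply: derivable_continuous => s; exact: test_fun_derivable1 tphi.
have [phi0 phiT] := test_fun_ends tphi.
have bnd f : {within `[0, T], continuous f} -> exists M, forall s, 0 < s <= T -> `|f s| <= M.
  move=> cf; have [K _ fK] := within_continuous_bounded (ltW T0) cf.
  by exists K => s /andP[s0 sT]; apply: fK; rewrite ltW.
have mul_int f1 f2 : measurable_fun `]0, T] f1 -> measurable_fun `]0, T] f2 ->
    (exists M, forall s, 0 < s <= T -> `|f1 s| <= M) ->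
    (exists M, forall s, 0 < s <= T -> `|f2 s| <= M) ->
    mu.-integrable `]0, T] (EFin \o (fun s => f1 s * f2 s)).
  move=> m1 m2 [M1 b1] [M2 b2]; apply: (@bounded_integrable_oc _ (M1 * M2)).
    exact: measurable_funM.
  by move=> s sT; rewrite normrM; apply: ler_pM => //; [exact: b1|exact: b2].
have cT f : continuous f -> {within `[0, T], continuous f} by exact: continuous_subspaceT.
have wphi := cT _ cphi; have wphi' := cT _ cphi'.
have i1 : mu.-integrable `]0, T] (EFin \o (fun s => u s * derive1 phi s)).
  apply: (mul_int); [exact: within_continuous_measurable_oc| |exact: bnd|exact: bnd].
  exact: within_continuous_measurable_oc.
have i2 : mu.-integrable `]0, T] (EFin \o (fun s => g s * phi s)).
  apply: (mul_int) => //; [exact: within_continuous_measurable_oc|by exists M|exact: bnd].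
(* The cells ]t i, t i.+1] tile ]0, T] exactly, hence the change to a half-open interval. *)
have oo f : mu.-integrable `]0, T] (EFin \o f) ->
    \int[mu]_(s in `]0, T[) f s = \int[mu]_(s in `]0, T]) f s.
  move=> fi; apply: Rintegral_itv_bndo_bndc; apply: integrableS fi => //.
  by move=> x /=; rewrite !in_itv /= => /andP[-> /ltW ->].
rewrite !oo//.
(* Boundary terms telescope: since phi(0) = 0, only the one at [t k] is left after k cells, and for
   k = N it vanishes because phi(T) = 0. *)
suff main k : (k <= N)%N ->
    \int[mu]_(s in `]0, t k]) (u s * derive1 phi s) =
    u (t k) * phi (t k) - \int[mu]_(s in `]0, t k]) (g s * phi s).
  by have := main N (leqnn N); rewrite (partitionN pt) phiT mulr0 add0r.
elim: k => [_|k ih kN].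
  by rewrite (partition0 pt) set_itv_ge ?bnd_simp// !Rintegral_set0 phi0 mulr0 subr0.
have tk0 := partition_ge0 pt (ltnW kN).
have tk1 := partition_leT pt kN.
have tkk := partition_lt pt kN.
have split_int f : mu.-integrable `]0, T] (EFin \o f) ->
    \int[mu]_(s in `]0, t k.+1]) f s =
    \int[mu]_(s in `]0, t k]) f s + \int[mu]_(s in `]t k, t k.+1]) f s.
  move=> fi; rewrite -(@Rintegral_itvB _ f (BRight 0) (BRight (t k.+1)) (t k)).
  - by rewrite addrC subrK.
  - apply: integrableS fi => // x /=; rewrite !in_itv /= => /andP[-> xt].
    exact: le_trans xt tk1.
  - by rewrite bnd_simp.
  - by rewrite bnd_simp ltW.
rewrite !split_int// ih ?(ltnW kN)//.
have sub : `]t k, t k.+1] `<=` `]0, T].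
  move=> x /=; rewrite !in_itv /= => /andP[x1 x2].
  by rewrite (le_lt_trans tk0 x1) (le_trans x2 tk1).
have subc : `[t k, t k.+1] `<=` `[0, T].
  move=> x /=; rewrite !in_itv /= => /andP[x1 x2].
  by rewrite (le_trans tk0 x1) (le_trans x2 tk1).
have -> : \int[mu]_(s in `]t k, t k.+1]) (g s * phi s) =
    \int[mu]_(s in `]t k, t k.+1]) (h k s * phi s).
  by apply: eq_Rintegral => s; rewrite inE /= in_itv /= => sk; rewrite (gh k kN).
have lr f : {within `[t k, t k.+1], continuous f} ->
    (forall s, t k < s < t k.+1 -> derivable f s 1) ->
    derivable_oo_LRcontinuous f (t k) (t k.+1).
  move=> /(continuous_within_itvP _ tkk)[_ l r] df; split; [|exact: l|exact: r].
  by move=> s; rewrite in_itv /=; exact: df.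
have icc f : {within `[t k, t k.+1], continuous f} ->
    \int[mu]_(s in `]t k, t k.+1]) f s = \int[mu]_(s in `[t k, t k.+1]) f s.
  move=> cf; apply: Rintegral_itv_obnd_cbnd.
  apply: (@integrableS _ _ _ mu `[t k, t k.+1]) => //.
    by move=> x /=; rewrite !in_itv /= => /andP[/ltW -> ->].
  by apply: continuous_compact_integrable => //; exact: segment_compact.
have cphik : {within `[t k, t k.+1], continuous phi} by exact: continuous_subspaceT.
have cphik' : {within `[t k, t k.+1], continuous (derive1 phi)} by exact: continuous_subspaceT.
have cuk : {within `[t k, t k.+1], continuous u} by exact: continuous_subspaceW cu.
rewrite !icc; last 2 first.
- by move=> x; apply: cvgM; [exact: (ch k kN)|exact: cphik].
- by move=> x; apply: cvgM; [exact: cuk|exact: cphik'].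
rewrite (@Rintegration_by_parts _ u phi (h k) (derive1 phi))//.
- ring.
- exact: ch.
- apply: lr => // s sk; by have [] := du k kN s sk.
- move=> s; rewrite in_itv /= => sk; rewrite derive1E.
  by have := du k kN s sk => dus; rewrite derive_val.
- by apply: lr => // s _; exact: test_fun_derivable tphi.
Qed.

End WeakDerivative.

(** * Piecewise C^1 functions as elements of H^1, strong and weak convergence *)

Section PiecewiseC1.
Variables (R : realType) (T : R).
Hypothesis T_gt0 : 0 < T.
Implicit Types (u g : R -> 'cV[R]_3) (h : nat -> R -> 'cV[R]_3) (N : nat) (t : nat -> R).

(** Packages the regularity required by [piecewise_ibp] for each component, in a form stable under
    differences. At a node [g] takes the value of the cell on its left. *)
Definition piecewise_C1 N t u g h :=
  [/\ forall j, {within `[0, T], continuous (fun s => u s j 0)},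
      forall i, (i < N)%N -> forall j, {within `[t i, t i.+1], continuous (fun s => h i s j 0)},
      forall i, (i < N)%N -> forall j s, t i < s < t i.+1 ->
        is_derive s 1 (fun s => u s j 0) (h i s j 0),
      forall i, (i < N)%N -> forall s, t i < s <= t i.+1 -> g s = h i s &
      forall j, measurable_fun `]0, T] (fun s => g s j 0)].

Lemma piecewise_C1B N t u g h u' g' h' :
  piecewise_C1 N t u g h -> piecewise_C1 N t u' g' h' ->
  piecewise_C1 N t (fun s => u s - u' s) (fun s => g s - g' s) (fun i s => h i s - h' i s).
Proof.
have sub (v v' : R -> 'cV[R]_3) j :
    (fun s => (v s - v' s) j 0) = (fun s => v s j 0) \- (fun s => v' s j 0).
  by apply/funext => s; rewrite !mxE.
move=> [cu ch du gh mg] [cu' ch' du' gh' mg']; split.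
- by move=> j; rewrite sub => x; apply: continuousB; [exact: cu|exact: cu'].
- by move=> i iN j; rewrite sub => x; apply: continuousB; [exact: ch|exact: ch'].
- move=> i iN j s sI; rewrite sub !mxE.
  by apply: is_deriveB; [exact: du|exact: du'].
- by move=> i iN s sI; rewrite (gh i iN s sI) (gh' i iN s sI).
- by move=> j; rewrite sub; apply: measurable_funB.
Qed.

Lemma piecewise_C1_H1 N t u g h M : is_partition T N t -> 0 <= M ->
  piecewise_C1 N t u g h ->
  (forall s, 0 < s <= T -> `|u s| <= M) -> (forall s, 0 < s <= T -> `|g s| <= M) ->
  weak_derivative T u g /\ (H1norm T u <= (4 * M * Num.sqrt T)%:E)%E.
Proof.
move=> pt M0 [cu ch du gh mg] uM gM.
have sub : `]0, T[ `<=` `]0, T].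
  by move=> x /=; rewrite !in_itv /= => /andP[-> /ltW ->].
have mg' j : measurable_fun `]0, T[ (fun s => g s j 0).
  exact: measurable_funS (mg j).
have mu' j : measurable_fun `]0, T[ (fun s => u s j 0).
  exact: measurable_funS (within_continuous_measurable_oc (cu j)).
have oT s : 0 < s < T -> 0 < s <= T by move=> /andP[-> /ltW ->].
have uM' s : 0 < s < T -> `|u s| <= M by move/oT; exact: uM.
have gM' s : 0 < s < T -> `|g s| <= M by move/oT; exact: gM.
have wd : weak_derivative T u g.
  split; [exact: L2_bounded M0 mu' uM'|exact: L2_bounded M0 mg' gM'|] => phi tphi j.
  apply: (@piecewise_ibp _ T N t _ _ (fun i s => h i s j 0) M) => //.
  - by move=> i iN; exact: ch.
  - by move=> i iN s; exact: du.
  - by move=> i iN s sI; rewrite (gh i iN).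
  - by move=> s sT; apply: le_trans (entry_le_norm _ _) (gM s sT).
split=> //.
have -> : 4 * M * Num.sqrt T = 2 * (2 * M * Num.sqrt T) by ring.
by apply: H1norm_le wd _ _; [rewrite !mulr_ge0 ?sqrtr_ge0|exact: L2norm_le|exact: L2norm_le].
Qed.

(** On ]t i, t i.+1] the function [cell] returns i.+1, so its predecessor is the index of the
    slope. *)
Lemma pwlinear_piecewise_C1 N t (y : nat -> 'cV[R]_3) : is_partition T N t ->
  piecewise_C1 N t (pwlinear N t y) (fun s => slope t y (cell N t s).-1)
    (fun i _ => slope t y i).
Proof.
move=> pt.
have pwE i j s : (i < N)%N -> t i <= s <= t i.+1 ->
    pwlinear N t y s j 0 = y i j 0 + (s - t i) * slope t y i j 0.
  by move=> iN /andP[h1 h2]; rewrite (pwlinearE pt y iN h1 h2) !mxE.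
split.
(* For one fixed partition the sum of all slopes is a sufficient Lipschitz constant; uniformity is
   not at stake here. *)
- move=> j; pose S := \sum_(i < N) `|slope t y i|.
  have S0 : 0 <= S by exact: sumr_ge0.
  have slS i : (i < N)%N -> `|slope t y i - 0| <= S.
    move=> iN; rewrite subr0 /S (bigD1 (Ordinal iN))//= lerDl.
    exact: sumr_ge0.
  have lip s r : 0 <= s -> s <= r -> r <= T ->
      `|pwlinear N t y r j 0 - pwlinear N t y s j 0| <= S * (r - s).
    move=> s0 sr rT.
    have := @pwlinear_mean_value _ _ _ _ pt y 0 S s r S0 s0 sr rT (fun i iN _ _ => slS i iN).
    rewrite scaler0 subr0; apply: le_trans.
    by have := entry_le_norm (pwlinear N t y r - pwlinear N t y s) j; rewrite !mxE.
  apply: (lipschitz_within_continuous S0) => s r /andP[s0 sT] /andP[r0 rT].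
  have [sr|rs] := leP s r.
    by rewrite distrC [`|s - r|]distrC [`|r - s|]ger0_norm ?subr_ge0// lip.
  by rewrite [`|s - r|]ger0_norm ?subr_ge0 ?lip ?(ltW rs).
- by move=> i iN j; apply: continuous_subspaceT => x; exact: cvg_cst.
- move=> i iN j s sI; apply: (is_derive_quadratic_error (C := 0) sI) => r rI.
  have le a : t i < a < t i.+1 -> t i <= a <= t i.+1 by move=> /andP[/ltW -> /ltW ->].
  rewrite (pwE i j r iN (le _ rI)) (pwE i j s iN (le _ sI)) mul0r normr_le0.
  by apply/eqP; ring.
- by move=> i iN s /andP[h1 h2]; rewrite (cellE pt iN h1 h2).
- by move=> j; exact: (measurable_cell_step N t (fun k => slope t y k.-1 j 0)).
Qed.

(** A C^1 function qualifies for every partition; taking that of an interpolation makes their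
    difference piecewise C^1. *)
Lemma primitive_piecewise_C1 N t u g : is_partition T N t ->
  (forall j, {within `[0, T], continuous (fun s => u s j 0)}) ->
  (forall j, {within `[0, T], continuous (fun s => g s j 0)}) ->
  (forall j s, 0 < s < T -> is_derive s 1 (fun s => u s j 0) (g s j 0)) ->
  piecewise_C1 N t u g (fun=> g).
Proof.
move=> pt cu cg du; split=> //.
- move=> i iN j; apply: continuous_subspaceW (cg j) => x /=; rewrite !in_itv /=.
  move=> /andP[h1 h2]; rewrite (le_trans (partition_ge0 pt (ltnW iN)) h1).
  by rewrite (le_trans h2 (partition_leT pt iN)).
- move=> i iN j s /andP[h1 h2]; apply: du.
  rewrite (le_lt_trans (partition_ge0 pt (ltnW iN)) h1).
  by rewrite (lt_le_trans h2 (partition_leT pt iN)).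
- by move=> j; exact: within_continuous_measurable_oc.
Qed.

Lemma weak_cvg_of_H1norm (w : nat -> R -> 'cV[R]_3) u (e : nat -> R) K : 0 <= K ->
  (forall n, H1 T (w n)) -> H1 T u -> (forall n, H1 T (fun s => w n s - u s)) ->
  (forall n, (H1norm T (fun s => w n s - u s)%R <= (K * e n)%:E)%E) ->
  (forall n, 0 <= e n) -> e n @[n --> \oo] --> 0 -> weak_cvg_H1 T w u.
Proof.
move=> K0 Hw Hu Hwu wuK e0 ecvg; split=> // l [lin [M lM]].
(* The bound [M] in [H1_dual] carries no sign, whence the absolute value. *)
pose K' := `|M| * K; have K'0 : 0 <= K' by rewrite mulr_ge0.
have bnd n : `|l u - l (w n)| <= K' * e n.
  have -> : l (w n) = l (fun s => w n s - u s) + l u.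
    rewrite -[X in X + _]mul1r -lin//; congr (l _).
    by apply/funext => s; rewrite scale1r subrK.
  rewrite opprD addrCA subrr addr0 normrN -lee_fin.
  apply: le_trans (lM _ (Hwu n)) _.
  apply: (@le_trans _ _ (`|M|%:E * H1norm T (fun s => w n s - u s)%R)%E).
    apply: lee_wpmul2r; last by rewrite lee_fin ler_norm.
    by apply: le_ereal_inf_tmp => _ [g _ <-]; exact: poweR_ge0.
  rewrite /K' -mulrA EFinM; apply: lee_wpmul2l (wuK n).
  by rewrite lee_fin.
apply/cvgrPdist_le => d d0; near=> n.
apply: le_trans (bnd n) _; apply: (@le_trans _ _ ((K' + 1) * (d / (K' + 1)))); last first.
  by rewrite mulrC divfK// lt0r_neq0// ltr_wpDl.
apply: ler_pM => //; first by rewrite lerDl.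
rewrite -[e n]ger0_norm//; near: n; apply: cvgr0_norm_le => //.
by rewrite divr_gt0// ltr_wpDl.
Unshelve. all: by end_near. Qed.

End PiecewiseC1.

(** * Uniqueness, uniform bounds and convergence of the scheme started at [y0] *)

Section Main.
Variables (R : realType) (m nu kappa lambda c : R) (y0 : 'cV[R]_3).
Hypotheses (m_gt0 : 0 < m) (nu_gt0 : 0 < nu) (kappa_gt0 : 0 < kappa)
    (lambda_gt0 : 0 < lambda) (c_gt0 : 0 < c) (th0_gt0 : 0 < thof y0).
Local Notation solution := (scheme_sol m nu kappa lambda c).
Local Notation G := (incr m nu kappa lambda c).
Local Notation vfield := (vfield m nu kappa lambda c).

(** The threshold nu c^2 / (lambda^2 E(y0)) is the convexity condition of [argmin_unique] at the
    initial energy; since the energy decays, it serves at every step. *)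
Lemma scheme_unique : exists2 taustar : R, 0 < taustar &
  forall (T : R) (N : nat) (t : nat -> R), is_partition T N t -> mesh N t <= taustar ->
    forall y z, solution N t y0 y -> solution N t y0 z ->
      forall i, (i <= N)%N -> y i = z i.
Proof.
have E0 : 0 < energy m kappa c y0.
  by apply: lt_le_trans (thof_energy c m_gt0 kappa_gt0 y0); rewrite mulr_gt0.
have lE0 : 0 < lambda ^+ 2 * energy m kappa c y0 by rewrite mulr_gt0// exprn_gt0.
exists (nu * c ^+ 2 / (lambda ^+ 2 * energy m kappa c y0)).
  by rewrite divr_gt0// mulr_gt0// exprn_gt0.
move=> T N t pt small y z sy sz; elim=> [_|i ih iN].
  by have [-> _] := sy; have [-> _] := sz.
have yz := ih (ltnW iN); have [_ ymin] := sy; have [_ zmin] := sz.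
have t0 : 0 < t i.+1 - t i by rewrite subr_gt0 (partition_lt pt).
have [yi0 Ei _] := scheme_invariants m_gt0 nu_gt0 kappa_gt0 c_gt0 th0_gt0 pt sy (ltnW iN).
apply: (argmin_unique m_gt0 nu_gt0 kappa_gt0 lambda_gt0 c_gt0 t0 yi0).
- apply: (@le_trans _ _ ((t i.+1 - t i) * (lambda ^+ 2 * energy m kappa c y0))).
    by rewrite -mulrA ler_pM2l// ler_pM2l// exprn_gt0.
  by rewrite -ler_pdivlMr// (le_trans (mesh_ge t iN)).
- exact: ymin.
- by rewrite yz; exact: zmin.
Qed.

Lemma incr_argmin_le0 tau eta y : 0 < tau -> 0 < thof eta ->
  argmin (G tau eta) y -> (G tau eta y <= 0)%E.
Proof.
move=> t0 e0 ymin.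
rewrite incr_fin ?lee_fin//; last exact: argmin_adm ymin.
exact: incr_val_le0 ymin.
Qed.

Lemma LopDE_le (B : R) : 0 <= B -> exists2 K : R, 0 <= K & forall y : 'cV[R]_3,
  `|y| <= B -> `|Lop lambda c y *m DE m kappa c y| <= K.
Proof.
move=> B0; pose K1 := m^-1 * B; pose K2 := kappa * B + lambda * B.
pose K3 := lambda / (m * c) * (B * B).
have K10 : 0 <= K1 by rewrite mulr_ge0// invr_ge0 ltW.
have K20 : 0 <= K2 by rewrite addr_ge0// mulr_ge0// ltW.
have K30 : 0 <= K3.
  by apply: mulr_ge0; [rewrite ltW// divr_gt0// mulr_gt0|exact: mulr_ge0].
exists (K1 + K2 + K3); first by apply: addr_ge0 => //; exact: addr_ge0.
move=> y yB; have hq := le_trans (qof_le_norm y) yB.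
have hp := le_trans (pof_le_norm y) yB; have ht := le_trans (thof_le_norm y) yB.
rewrite LopDE//; apply: cV3_norm_le; rewrite vec3E.
- apply: (@le_trans _ _ K1); last by lra.
  by rewrite mulrC; apply: ler_norm_pM; rewrite ?invr_gt0.
- apply: (@le_trans _ _ K2); last by lra.
  by apply: le_trans (ler_normB _ _) _; rewrite normrN; apply: lerD; exact: ler_norm_pM.
- apply: (@le_trans _ _ K3); last by lra.
  have -> : lambda * thof y * pof y / (m * c) = lambda / (m * c) * (thof y * pof y) by ring.
  apply: ler_norm_pM; first by rewrite divr_gt0// mulr_gt0.
  by rewrite normrM; exact: ler_pM.
Qed.

Lemma DS_le (d : R) : 0 < d -> exists2 K : R, 0 <= K & forall y : 'cV[R]_3,
  d <= thof y -> `|DS lambda c y| <= K.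
Proof.
move=> d0; have cd0 : 0 < c / d by rewrite divr_gt0.
exists (lambda + c / d); first by rewrite addr_ge0// ltW.
move=> y dy; have y0' := lt_le_trans d0 dy.
apply: cV3_norm_le; rewrite vec3E.
- by rewrite normrN gtr0_norm// lerDl ltW.
- by rewrite normr0 addr_ge0// ltW.
- rewrite gtr0_norm ?divr_gt0//; apply: (@le_trans _ _ (c / d)).
    by rewrite ler_pM2l// lef_pV2 ?posrE.
  by rewrite lerDr ltW.
Qed.

Lemma cell_gt0_le (T : R) N (t : nat -> R) s : is_partition T N t -> 0 < s <= T ->
  (0 < cell N t s <= N)%N.
Proof.
move=> pt /andP[s0 sT]; have [i [iN h1 h2]] := in_cell pt s0 sT.
by rewrite (cellE pt iN h1 h2).
Qed.

Lemma scheme_bounds (T : R) : 0 < T -> exists C thmin : R, [/\ 0 < C, 0 < thmin &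
  forall (N : nat) (t : nat -> R) (y : nat -> 'cV[R]_3),
    is_partition T N t -> solution N t y0 y ->
    let yhat := pwlinear N t y in
    let ybar := pwconst N t y in
    let LDE := fun s => Lop lambda c (ybar s) *m DE m kappa c (ybar s) in
    let DSbar := fun s => DS lambda c (ybar s) in
    [/\ forall i, (i <= N)%N -> enorm (y i) <= C /\ thmin <= thof (y i),
        H1 T yhat /\ (H1norm T yhat <= C%:E)%E,
        L2 T LDE /\ (L2norm T LDE <= C%:E)%E
      & L2 T DSbar /\ (L2norm T DSbar <= C%:E)%E]].
Proof.
move=> T0.
have [B [d [A [S [[B0 d0 A0 S0] est]]]]] :=
  scheme_approx m_gt0 nu_gt0 kappa_gt0 lambda_gt0 c_gt0 T0 th0_gt0.
have [K1 K10 LB] := LopDE_le (ltW B0); have [K2 K20 DB] := DS_le d0.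
set sT := Num.sqrt T; have sT0 : 0 <= sT by exact: sqrtr_ge0.
have BS0 : 0 <= B + S by rewrite addr_ge0// ltW.
have p1 : 0 <= 4 * (B + S) * sT by rewrite mulr_ge0// mulr_ge0.
have p2 : 0 <= 2 * K1 * sT by rewrite mulr_ge0// mulr_ge0.
have p3 : 0 <= 2 * K2 * sT by rewrite mulr_ge0// mulr_ge0.
exists (2 * B + 4 * (B + S) * sT + 2 * K1 * sT + 2 * K2 * sT), d; split=> //; first lra.
move=> N t y pt sy yhat ybar LDE DSbar; have [bnd sl [apB _] _] := est N t y pt sy.
have ybarB s : 0 < s < T -> `|ybar s| <= B /\ d <= thof (ybar s).
  move=> /andP[s0 /ltW sT']; apply: bnd.
  by have /andP[] : (0 < cell N t s <= N)%N by apply: (cell_gt0_le pt); rewrite s0.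
have mstep (f : 'cV[R]_3 -> 'cV[R]_3) i : measurable_fun `]0, T[ (fun s => f (ybar s) i 0).
  exact: (measurable_cell_step N t (fun k => f (y k) i 0)).
split.
- move=> i iN; have [yB yd] := bnd i iN; split=> //.
  by apply: le_trans (enorm_le_norm _) _; lra.
- have [s sT'|s sT'|wd nrm] := piecewise_C1_H1 T0 pt BS0 (pwlinear_piecewise_C1 y pt).
  + by apply: (@le_trans _ _ B); [apply: apB; case/andP: sT' => /ltW -> ->|rewrite lerDl].
  + apply: (@le_trans _ _ S); last by rewrite lerDr ltW.
    have /andP[k0 kN] := cell_gt0_le pt sT'; apply: sl.
    by rewrite prednK.
  split; first by exists (fun s => slope t y (cell N t s).-1).
  by apply: le_trans nrm _; rewrite lee_fin -/sT; lra.
- have mL := mstep (fun v => Lop lambda c v *m DE m kappa c v).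
  have bL s : 0 < s < T -> `|LDE s| <= K1 by move=> /ybarB[+ _]; exact: LB.
  split; first exact: L2_bounded K10 mL bL.
  by apply: le_trans (L2norm_le T0 K10 mL bL) _; rewrite lee_fin -/sT; lra.
- have mD := mstep (fun v => DS lambda c v).
  have bD s : 0 < s < T -> `|DSbar s| <= K2 by move=> /ybarB[_]; exact: DB.
  split; first exact: L2_bounded K20 mD bD.
  by apply: le_trans (L2norm_le T0 K20 mD bD) _; rewrite lee_fin -/sT; lra.
Qed.

Lemma oscillator_piecewise_C1 (T : R) N (t : nat -> R) z B A : 0 < T -> is_partition T N t ->
  oscillator_sol m nu kappa lambda c T y0 z ->
  0 <= B -> 0 <= A -> approx_sol vfield T B A 0 z ->
  piecewise_C1 T N t z (vfield \o z) (fun=> vfield \o z).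
Proof.
move=> T0 pt [_ [cq [cp ct]] dz] B0 A0 zA.
have [S S0 lip] := approx_sol_lipschitz m_gt0 nu_gt0 kappa_gt0 lambda_gt0 c_gt0 (ltW T0) B0 A0 zA.
have [L L0 FL] := vfield_lipschitz m_gt0 nu_gt0 kappa_gt0 lambda_gt0 c_gt0 B0.
apply: primitive_piecewise_C1 => //.
- by apply: ord3P.
- move=> j; apply: (@lipschitz_within_continuous _ _ (L * S)); first exact: mulr_ge0.
  move=> s r sT rT.
  have := entry_le_norm (vfield (z s) - vfield (z r)) j; rewrite !mxE => /le_trans; apply.
  have [zB _] := zA; apply: le_trans (FL _ _ (zB s sT) (zB r rT)) _.
  by rewrite -mulrA ler_wpM2l// lip.
- move=> j s sT; have := dz s; rewrite in_itv /= => /(_ sT)[d1 d2 d3].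
  move: j; apply: ord3P.
  + by change (is_derive s 1 (fun s => qof (z s)) (qof (vfield (z s)))); rewrite vec3E.
  + by change (is_derive s 1 (fun s => pof (z s)) (pof (vfield (z s)))); rewrite vec3E.
  + by change (is_derive s 1 (fun s => thof (z s)) (thof (vfield (z s)))); rewrite vec3E.
Qed.

Lemma scheme_cvg (T : R) z B' A' : 0 < T -> oscillator_sol m nu kappa lambda c T y0 z ->
  0 <= B' -> 0 <= A' -> approx_sol vfield T B' A' 0 z ->
  forall (N : nat -> nat) (t : nat -> nat -> R) (y : nat -> nat -> 'cV[R]_3),
    (forall n, is_partition T (N n) (t n)) ->
    mesh (N n) (t n) @[n --> \oo] --> 0 ->
    (forall n, solution (N n) (t n) y0 (y n)) ->
    weak_cvg_H1 T (fun n => pwlinear (N n) (t n) (y n)) z.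
Proof.
move=> T0 zsol B'0 A'0 zA N t y pt mesh0 sy.
have [B [d [A [S [[B0 d0 A0 S0] est]]]]] :=
  scheme_approx m_gt0 nu_gt0 kappa_gt0 lambda_gt0 c_gt0 T0 th0_gt0.
have BB0 : 0 <= B + B' by rewrite addr_ge0// ltW.
have AA0 : 0 <= A + A' by rewrite addr_ge0.
have [L L0 FL] := vfield_lipschitz m_gt0 nu_gt0 kappa_gt0 lambda_gt0 c_gt0 BB0.
pose e n := Num.sqrt (mesh (N n) (t n)).
have e0 n : 0 <= e n by exact: sqrtr_ge0.
pose C := T * (A + A') * expR (L * T).
have C0 : 0 <= C by rewrite !mulr_ge0 ?expR_ge0// ltW.
have z0 : z 0 = y0 by case: zsol.
have zC n : piecewise_C1 T (N n) (t n) z (vfield \o z) (fun=> vfield \o z).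
  exact: oscillator_piecewise_C1 zA.
have wC n := pwlinear_piecewise_C1 (y n) (pt n).
(* With common constants, the interpolations and [z] can be compared, with errors [e n] and 0. *)
have zA' : approx_sol vfield T (B + B') (A + A') 0 z.
  by apply: approx_sol_le zA; rewrite ?lerDr// ltW.
have dist n s : 0 <= s <= T -> `|pwlinear (N n) (t n) (y n) s - z s| <= C * e n.
  have [_ _ wA _] := est _ _ _ (pt n) (sy n).
  have wA' : approx_sol vfield T (B + B') (A + A') (e n) (pwlinear (N n) (t n) (y n)).
    by apply: approx_sol_le wA; rewrite ?lerDl.
  move=> sT; rewrite -[e n]addr0.
  apply: (approx_sol_dist L0 AA0 FL (e0 n) (lexx 0) wA' zA') => //.
  by rewrite z0 (pwlinear0 (pt n)); have [] := sy n.
(* C bounds the distance of the functions and A + L C that of the derivatives: consistency of the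
   slope, plus the exchange of the interpolation for [z] inside the field. *)
pose K := C + A + L * C.
have K0 : 0 <= K by apply: addr_ge0; [exact: addr_ge0|exact: mulr_ge0].
have LC0 : 0 <= L * C by rewrite mulr_ge0.
have wz n : weak_derivative T (fun s => pwlinear (N n) (t n) (y n) s - z s)
      (fun s => slope (t n) (y n) (cell (N n) (t n) s).-1 - (vfield \o z) s) /\
    (H1norm T (fun s => pwlinear (N n) (t n) (y n) s - z s)%R
      <= (4 * (K * e n) * Num.sqrt T)%:E)%E.
  apply: (piecewise_C1_H1 T0 (pt n) _ (piecewise_C1B (wC n) (zC n))).
  - by rewrite mulr_ge0.
  - move=> s /andP[/ltW s0 sT]; apply: le_trans (dist n s _) _; first by rewrite s0.
    by rewrite ler_wpM2r// /K; lra.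
  - move=> s /andP[s0 sT]; have sT' : 0 <= s <= T by rewrite ltW.
    have [i [iN h1 h2]] := in_cell (pt n) s0 sT; rewrite (cellE (pt n) iN h1 h2) /=.
    have [_ _ [wB _] sl] := est _ _ _ (pt n) (sy n).
    have := sl i s iN (ltW h1) h2; set w := pwlinear _ _ _ s => h3.
    rewrite -(subrK (vfield w) (slope _ _ _)) -addrA.
    apply: le_trans (ler_normD _ _) _.
    have [zB _] := zA.
    have h4 : `|vfield w - vfield (z s)| <= L * (C * e n).
      apply: (@le_trans _ _ (L * `|w - z s|)).
        by apply: FL; [apply: le_trans (wB s sT') _|apply: le_trans (zB s sT') _];
          rewrite ?lerDl ?lerDr// ltW.
      by rewrite ler_wpM2l// dist.
    apply: le_trans (lerD h3 h4) _; rewrite mulrA -mulrDl ler_wpM2r//.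
    by rewrite /K; lra.
apply: (@weak_cvg_of_H1norm _ T _ _ e (4 * K * Num.sqrt T)).
- by rewrite !mulr_ge0 ?sqrtr_ge0.
- move=> n; have [bnd sl [wB _] _] := est _ _ _ (pt n) (sy n).
  have [||wd _] := piecewise_C1_H1 T0 (pt n) (addr_ge0 (ltW B0) S0) (wC n).
  + move=> s /andP[/ltW s0 sT]; apply: (@le_trans _ _ B); last by rewrite lerDl.
    by apply: wB; rewrite s0.
  + move=> s sT; apply: (@le_trans _ _ S); last by rewrite lerDr ltW.
    by have /andP[k0 kN] := cell_gt0_le (pt n) sT; apply: sl; rewrite prednK.
  by exists (fun s => slope (t n) (y n) (cell (N n) (t n) s).-1).
- have [L' L'0 FL'] := vfield_lipschitz m_gt0 nu_gt0 kappa_gt0 lambda_gt0 c_gt0 B'0.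
  have [zB _] := zA.
  have BL0 : 0 <= B' + L' * B' by rewrite addr_ge0// mulr_ge0.
  have [||wd _] := piecewise_C1_H1 T0 (pt 0%N) BL0 (zC 0%N).
  + move=> s /andP[/ltW s0 sT]; apply: (@le_trans _ _ B'); last by rewrite lerDl mulr_ge0.
    by apply: zB; rewrite s0.
  + move=> s /andP[/ltW s0 sT]; have sT' : 0 <= s <= T by rewrite s0.
    apply: le_trans (vfield_bound B'0 FL' (zB s sT')) _.
    apply: (@le_trans _ _ (L' * B')); first by rewrite ler_wpM2l// zB.
    by rewrite lerDr.
  by exists (vfield \o z).
- by move=> n; have [wd _] := wz n; eexists; exact: wd.
- move=> n; have [_] := wz n.
  by rewrite (_ : 4 * K * _ * _ = 4 * (K * e n) * Num.sqrt T)//; ring.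
- exact: e0.
- rewrite -[X in _ --> X](@sqrtr0 R).
  by apply: continuous_cvg => //; exact: sqrt_continuous.
Qed.

End Main.

Theorem mainTheorem2 (R : realType) (m nu kappa lambda c : R) (y0 : 'cV[R]_3)
    (m_gt0 : 0 < m) (nu_gt0 : 0 < nu) (kappa_gt0 : 0 < kappa)
    (lambda_gt0 : 0 < lambda) (c_gt0 : 0 < c) (th0_gt0 : 0 < thof y0) :
  let G := incr m nu kappa lambda c in
  let solution := scheme_sol m nu kappa lambda c in
  (* (a) existence *)
  (forall (T : R) (N : nat) (t : nat -> R), 0 < T -> is_partition T N t ->
     (forall i eta, (i < N)%N -> 0 < thof eta ->
        argmin (G (t i.+1 - t i) eta) !=set0 /\
        forall y, argmin (G (t i.+1 - t i) eta) y -> 0 < thof y) /\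
     (exists y, solution N t y0 y))
  /\
  (* (b) uniqueness, with a threshold independent of T *)
  (exists2 taustar : R, 0 < taustar &
     forall (T : R) (N : nat) (t : nat -> R), 0 < T -> is_partition T N t -> mesh N t <= taustar ->
       forall y z, solution N t y0 y -> solution N t y0 z ->
         forall i, (i <= N)%N -> y i = z i)
  /\
  (* (c) *)
  (forall (T : R) (N : nat) (t : nat -> R) (y : nat -> 'cV[R]_3),
     0 < T -> is_partition T N t -> solution N t y0 y ->
     forall i, (i < N)%N -> (G (t i.+1 - t i)%R (y i) (y i.+1) <= 0)%E)
  /\
  (* (d) a priori bounds *)
  (forall T : R, 0 < T ->
     exists C thmin : R, [/\ 0 < C, 0 < thmin &
       forall (N : nat) (t : nat -> R) (y : nat -> 'cV[R]_3),
         is_partition T N t -> solution N t y0 y ->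
         let yhat := pwlinear N t y in
         let ybar := pwconst N t y in
         let LDE := fun s => Lop lambda c (ybar s) *m DE m kappa c (ybar s) in
         let DSbar := fun s => DS lambda c (ybar s) in
         [/\ forall i, (i <= N)%N -> enorm (y i) <= C /\ thmin <= thof (y i),
             H1 T yhat /\ (H1norm T yhat <= C%:E)%E,
             L2 T LDE /\ (L2norm T LDE <= C%:E)%E
           & L2 T DSbar /\ (L2norm T DSbar <= C%:E)%E]])
  /\
  (* (e) convergence to the unique solution of the oscillator system *)
  (forall T : R, 0 < T ->
     exists ylim : R -> 'cV[R]_3,
       [/\ oscillator_sol m nu kappa lambda c T y0 ylim,
           forall z, oscillator_sol m nu kappa lambda c T y0 z ->
             forall s, s \in `[0, T] -> z s = ylim s
         & forall (N : nat -> nat) (t : nat -> nat -> R)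
             (y : nat -> nat -> 'cV[R]_3),
             (forall n, is_partition T (N n) (t n)) ->
             mesh (N n) (t n) @[n --> \oo] --> 0 ->
             (forall n, solution (N n) (t n) y0 (y n)) ->
             weak_cvg_H1 T (fun n => pwlinear (N n) (t n) (y n)) ylim]).
Proof.
move=> G solution; split; [|split; [|split; [|split]]].
- move=> T N t T0 pt; split; last first.
    by apply: (scheme_exists m_gt0 nu_gt0 kappa_gt0 lambda_gt0 c_gt0 th0_gt0 pt).
  move=> i eta iN e0; have t0 : 0 < t i.+1 - t i by rewrite subr_gt0 (partition_lt pt).
  split; first by apply: argmin_exists.
  by move=> y /(argmin_adm m_gt0 nu_gt0 kappa_gt0 c_gt0 t0 e0)[].
- have [tau tau0 uniq] := scheme_unique m_gt0 nu_gt0 kappa_gt0 lambda_gt0 c_gt0 th0_gt0.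
  by exists tau => // T N t _; exact: uniq.
- move=> T N t y T0 pt sy i iN.
  have t0 : 0 < t i.+1 - t i by rewrite subr_gt0 (partition_lt pt).
  have [yi0 _ _] := scheme_invariants m_gt0 nu_gt0 kappa_gt0 c_gt0 th0_gt0 pt sy (ltnW iN).
  by apply: incr_argmin_le0 => //; have [_] := sy; apply.
- by move=> T T0; apply: scheme_bounds.
- move=> T T0.
  have [z [zsol [B [A [B0 A0 zA]]]]] :=
    oscillator_exists m_gt0 nu_gt0 kappa_gt0 lambda_gt0 c_gt0 T0 th0_gt0.
  exists z; split=> //.
    move=> z' z'sol s; rewrite in_itv /=.
    exact: (oscillator_unique m_gt0 nu_gt0 kappa_gt0 lambda_gt0 c_gt0 T0 z'sol zsol).
  by move=> N t y pt mesh0 sy; apply: scheme_cvg zA _ _ _ pt mesh0 sy.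
Qed.
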